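(* Let $n=2m$ be an even positive integer and $\mathbf{x}=(x_1,\dots,x_n)\in(0,\infty)^n$. Then $$E(\mathbf{x})=\sum_{k\in\{2,4,\dots,n\}}\ \sum_{\mathbf{o}\in\mathcal{O}_k}P(\mathbf{o})\,f(\mathbf{o},\mathbf{x}),$$ with $E$, $\mathcal{O}_k$, $P$ and $f$ as defined in the context.
   Context: For $\mathbf{x}=(x_1,\dots,x_n)\in(0,\infty)^n$ with $n=2m$, let $\mathcal{C}(\mathbf{x})$ be the configuration of $n+1$ points $P_1<\dots<P_{n+1}$ on $\mathbb{R}$ with $P_1=0$ and $P_{i+1}=P_i+x_i$, where $P_i$ is red if $i$ is odd and blue if $i$ is even ($m+1$ red and $m$ blue points). A matching $\mathcal{M}$ of this configuration is produced by the algorithm which repeatedly selects, among all pairs consisting of an unmatched blue point and an unmatched red point, a pair at minimum distance, and matches them, until no further matching is possible; ties are broken at random. $D(\mathbf{x})$ is the expected value of $\sum_{P\text{ blue}}|P-\mathcal{M}(P)|$ with respect to the randomness of this algorithm. For a permutation $\pi$ of $\{1,\dots,n\}$ write $\pi(\mathbf{x})=(x_{\pi(1)},\dots,x_{\pi(n)})$, and define $E(\mathbf{x})=\frac{1}{n!}\sum_{\pi}D(\pi(\mathbf{x}))$. For a positive integer $k$, $\mathcal{O}_k$ is the set of all multisets $\mathbf{o}=\{o_1,\dots,o_r\}$ of odd positive integers with $\sum_{i=1}^r o_i=k$; $c(\mathbf{o},i)$ is the number of times $i$ appears in $\mathbf{o}$, and $P(\mathbf{o})=\dfrac{2^{r-1}}{\prod_{i=1}^k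 i^{c(\mathbf{o},i)}c(\mathbf{o},i)!}$. For $\mathbf{o}\in\mathcal{O}_k$ with $k\le n$, $\Phi(\mathbf{o},\mathbf{x})$ is the set of all ways to choose an unordered collection of pairwise disjoint subsets $S_1,\dots,S_r$ of the index set $\{1,\dots,n\}$ with sizes $o_1,\dots,o_r$ (so $|\Phi(\mathbf{o},\mathbf{x})|=\frac{n!}{(n-k)!\prod_{i=1}^r o_i!\prod_{i=1}^k c(\mathbf{o},i)!}$), and $f(\mathbf{o},\mathbf{x})=\frac{1}{|\Phi(\mathbf{o},\mathbf{x})|}\sum_{\{S_1,\dots,S_r\}\in\Phi(\mathbf{o},\mathbf{x})}\min\bigl(\sum_{i\in S_1}x_i,\dots,\sum_{i\in S_r}x_i\bigr)$. *)

(* Defs.v *)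
From HB Require Import structures.
From mathcomp Require Import all_boot all_order all_algebra all_fingroup.
Set Implicit Arguments. Unset Strict Implicit. Unset Printing Implicit Defensive.
Import Order.TTheory GRing.Theory Num.Theory.
Local Open Scope ring_scope.

Section Defs.
Variable R : realFieldType.

(* Points are indexed 0..n (0-based); point i (0-based) is P_{i+1} of the paper.
   P_{i+1} = x_1 + ... + x_i, i.e. position of index i is the sum of the first i
   gaps.  Index i is blue iff odd i (paper: P_j blue iff j even). *)
Definition pos (n : nat) (x : 'I_n -> R) (i : 'I_n.+1) : R :=
  \sum_(j < n | (j < i)%N) x j.

Definition blue (n : nat) (i : 'I_n.+1) : bool := odd i.
Definition red (n : nat) (i : 'I_n.+1) : bool := ~~ odd i.

Definition pdist (n : nat) (x : 'I_n -> R) (p : 'I_n.+1 * 'I_n.+1) : R :=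
  `|pos x p.1 - pos x p.2|.

Definition validp (n : nat) (U : {set 'I_n.+1}) (p : 'I_n.+1 * 'I_n.+1) : bool :=
  [&& p.1 \in U, p.2 \in U, blue p.1 & red p.2].

Definition minpairs (n : nat) (x : 'I_n -> R) (U : {set 'I_n.+1}) :
    {set 'I_n.+1 * 'I_n.+1} :=
  [set p | validp U p && [forall q, validp U q ==> (pdist x p <= pdist x q)]].

(* Expected remaining cost of the greedy algorithm from the set U of unmatched
   points, ties broken uniformly at random among the minimum-distance pairs.
   [fuel] bounds the number of steps (each step removes two points). *)
Fixpoint greedyE (n : nat) (x : 'I_n -> R) (fuel : nat) (U : {set 'I_n.+1}) : R :=
  match fuel with
  | 0 => 0
  | f.+1 =>
      if minpairs x U == set0 then 0
      else (#|minpairs x U|%:R)^-1 *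
           \sum_(p in minpairs x U) (pdist x p + greedyE x f (U :\ p.1 :\ p.2))
  end.

Definition D (n : nat) (x : 'I_n -> R) : R := greedyE x n.+1 [set: 'I_n.+1].

Definition E (n : nat) (x : 'I_n -> R) : R :=
  (n`!%:R)^-1 * \sum_(s : 'S_n) D (fun i => x (s i)).

(* A multiset o of positive integers with sum k is encoded by its multiplicity
   function c : i |-> c(o,i), for i = 0..k (every part and every multiplicity is
   at most k). *)
Definition mult (k : nat) := {ffun 'I_k.+1 -> 'I_k.+1}.

Definition inO (k : nat) (c : mult k) : bool :=
  [forall i : 'I_k.+1, (c i != 0%N :> nat) ==> odd i] &&
  (\sum_(i < k.+1) i * c i == k)%N.

Definition nparts (k : nat) (c : mult k) : nat := (\sum_(i < k.+1) c i)%N.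

Definition Pw (k : nat) (c : mult k) : R :=
  (2 ^+ (nparts c).-1) /
  \prod_(i < k.+1 | (0 < i)%N) ((i : nat) ^ (c i) * (c i)`!)%:R.

(* Phi(o,x): unordered collections {S_1,...,S_r} of pairwise disjoint subsets of
   the index set, with sizes o_1,...,o_r (as a multiset). *)
Definition inPhi (n k : nat) (c : mult k) (F : {set {set 'I_n}}) : bool :=
  [&& trivIset F,
      [forall A in F, #|A| <= k]%N &
      [forall i : 'I_k.+1, #|[set A in F | #|A| == i]| == c i]].

Definition Phi (n k : nat) (c : mult k) : {set {set {set 'I_n}}} :=
  [set F | inPhi c F].

Definition minsum (n : nat) (x : 'I_n -> R) (F : {set {set 'I_n}}) : R :=
  let l := [seq \sum_(i in A) x i | A : {set 'I_n} <- enum F] in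
  \big[Order.min/head 0 l]_(v <- l) v.

Definition fval (n k : nat) (c : mult k) (x : 'I_n -> R) : R :=
  (#|Phi n c|%:R)^-1 * \sum_(F in Phi n c) minsum x F.

End Defs.

(* Main.v *)
Require Import Defs.
From HB Require Import structures.
From mathcomp Require Import all_boot all_order all_algebra all_fingroup.
From mathcomp Require Import zify ring.
Set Implicit Arguments. Unset Strict Implicit. Unset Printing Implicit Defensive.
Import Order.TTheory GRing.Theory Num.Theory.
Local Open Scope ring_scope.

(** The unmatched points always alternate in colour, so a greedy step picks a
    shortest gap j and deletes its two endpoints: an interior gap j merges with its
    neighbours a and b into a single gap, an extreme gap j disappears together with
    its only neighbour a.  Averaging over all arrangements of the gaps gives, for j a
    shortest of n gaps,

      n(n-1) E(x) = n(n-1) x_j + sum_{(a,b)} E(x with a,j,b merged)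
                               + 2 sum_a E(x without j,a).

    On the other side, P(o) f(o,x) is the sum of
    (n-k)!/(2 n!) * prod_{A in F} 2(|A|-1)! * min_{A in F} x(A) over the families F of
    type o, and this sum over all families of disjoint odd blocks with an even number
    of covered indices satisfies the same recursion: split the families according to
    whether j is uncovered, is a block of its own (then the minimum is x_j), or lies
    in a block of size s >= 3, from which an ordered pair (a,b) can be removed in
    (s-1)(s-2) ways. *)

(** * Families of disjoint odd blocks *)

Section OddFamilies.
Variables (R : realFieldType) (I : finType).
Implicit Types (U A B : {set I}) (F G : {set {set I}}).

Definition oddfam U F :=
  [&& trivIset F, [forall A in F, odd #|A|] & cover F \subset U].

(** An [s]-set has [(s-1)!] cyclic orders, so for an odd family this counts the permutations of
    [cover F] whose cycles have the blocks as supports, each cycle carrying a factor 2. *)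
Definition weight F : R := \prod_(A in F) (2 * (#|A|.-1)`!)%:R.

Lemma oddfamP U F : reflect
  [/\ trivIset F, (forall A, A \in F -> odd #|A|) & cover F \subset U]
  (oddfam U F).
Proof. by apply: (iffP and3P) => -[? /forall_inP ? ?]; split=> //; apply/forall_inP. Qed.

Lemma sub_cover F A : A \in F -> A \subset cover F.
Proof. by move=> AF; apply: (bigcup_sup A). Qed.

Lemma trivIset_addblock F B : [disjoint B & cover F] -> trivIset F -> trivIset (B |: F).
Proof.
move=> dB tF; apply/trivIsetP => C D /setU1P[->|CF] /setU1P[->|DF] nCD.
- by rewrite eqxx in nCD.
- exact: disjointWr (sub_cover DF) dB.
- by rewrite disjoint_sym; apply: disjointWr (sub_cover CF) dB.
- by move/trivIsetP: tF; apply.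
Qed.

Lemma trivIset_swap F A B : trivIset F -> [disjoint B & cover (F :\ A)] ->
  trivIset (B |: F :\ A).
Proof.
by move=> tF dB; apply: trivIset_addblock => //; apply: trivIsetS tF; apply: subsetDl.
Qed.

Lemma cover_setU1 F A : cover (A |: F) = A :|: cover F.
Proof.
apply/setP=> i; rewrite inE; apply/bigcupP/orP.
  by case=> B /setU1P[->|BF] iB; [left|right => //; apply/bigcupP; exists B].
case=> [iA|/bigcupP[B BF iB]]; first by exists A; rewrite ?setU11.
by exists B; rewrite ?setU1r.
Qed.

Lemma coverD1_disjoint F A : A \in F -> trivIset F -> [disjoint A & cover (F :\ A)].
Proof.
move=> AF tF; apply/bigcup_disjointP => B.
rewrite inE in_set1 => /andP[nBA BF].
by move/trivIsetP: tF; apply => //; rewrite eq_sym.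
Qed.

Lemma coverE1 F A : A \in F -> cover F = A :|: cover (F :\ A).
Proof. by move=> AF; rewrite -cover_setU1 setD1K. Qed.

Lemma weightE1 F A : A \in F -> weight F = (2 * (#|A|.-1)`!)%:R * weight (F :\ A).
Proof. by move=> AF; rewrite /weight (big_setD1 A). Qed.

Lemma oddfam_set0 U F : oddfam U F -> set0 \notin F.
Proof. by case/oddfamP=> _ oF _; apply/negP => /oF; rewrite cards0. Qed.

(* Inverse to each other: they enlarge, resp. shrink, the block containing [j]. *)
Definition addpair (j a b : I) G :=
  (pblock G j :|: [set a; b]) |: G :\ pblock G j.
Definition rempair (j a b : I) F :=
  (pblock F j :\: [set a; b]) |: F :\ pblock F j.

Lemma cards_setUpair A a b : a \notin A -> b \notin A -> a != b ->
  #|A :|: [set a; b]| = #|A|.+2.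
Proof.
move=> aA bA ab; rewrite setUA ![_ :|: [set _]]setUC !cardsU1 !inE negb_or aA bA.
by rewrite eq_sym ab.
Qed.

Lemma cards_setDpair A a b : a \in A -> b \in A -> a != b ->
  #|A :\: [set a; b]| = (#|A| - 2)%N.
Proof.
by move=> aA bA ab; rewrite cardsDS ?cards2 ?ab //; apply/subsetP=> i /set2P[]->.
Qed.

Lemma fresh_block F B : B != set0 -> [disjoint B & cover F] -> B \notin F.
Proof.
move=> B0 dB; apply/negP => BF; case/set0Pn: B0 => i iB.
by have := disjointFr dB iB; rewrite (_ : i \in cover F) //; apply/bigcupP; exists B.
Qed.

Section Pair.
Variables (U : {set I}) (j a b : I).
Hypotheses (aU : a \in U) (bU : b \in U) (aj : a != j) (bj : b != j) (ab : a != b).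

Section Add.
Variable G : {set {set I}}.
Hypotheses (oG : oddfam (U :\ a :\ b) G) (jG : j \in cover G).
Let A := pblock G j.
Let B := A :|: [set a; b].
Let G' := G :\ A.

Lemma addpair_block :
  [/\ trivIset G, A \in G, j \in A, (a \notin cover G) && (b \notin cover G) &
    [disjoint B & cover G']].
Proof.
case/oddfamP: oG => tG odG sG.
have AG : A \in G by apply: pblock_mem.
have nn : (a \notin cover G) && (b \notin cover G).
  by apply/andP; split; apply/negP => /(subsetP sG); rewrite !inE eqxx ?andbF.
split=> //; first by rewrite mem_pblock.
have := coverD1_disjoint AG tG; rewrite -!setI_eq0 setIUl => /eqP->.
rewrite set0U setI_eq0 disjoint_sym disjoints_subset.
apply/subsetP=> i iG; rewrite !inE.
have iC : i \in cover G by rewrite (coverE1 AG) inE iG orbT.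
by case/andP: nn => na nb; rewrite negb_or; apply/andP; split; apply: contraTneq iC => ->.
Qed.

Let aA : a \notin A.
Proof.
have [_ AG _ /andP[na _] _] := addpair_block; apply: contra na => aA.
by apply/bigcupP; exists A.
Qed.
Let bA : b \notin A.
Proof.
have [_ AG _ /andP[_ nb] _] := addpair_block; apply: contra nb => bA.
by apply/bigcupP; exists A.
Qed.

Lemma addpairE : addpair j a b G = B |: G'. Proof. by []. Qed.

Lemma card_addpair_block : #|B| = #|A|.+2. Proof. exact: cards_setUpair. Qed.

Lemma addpair_block_notin : B \notin G'.
Proof.
have [_ _ _ _ dB] := addpair_block; apply: fresh_block dB => //.
by rewrite -card_gt0 card_addpair_block.
Qed.

Lemma pblock_addpair : pblock (addpair j a b G) j = B.
Proof.
have [tG AG jA _ dB] := addpair_block; apply: def_pblock.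
- exact: trivIset_swap.
- exact: setU11.
- by rewrite inE jA.
Qed.

Lemma addpair_oddfam : oddfam U (addpair j a b G).
Proof.
have [tG AG jA _ dB] := addpair_block; case/oddfamP: oG => _ odG sG.
apply/oddfamP; split; first exact: trivIset_swap.
  move=> C /setU1P[->|]; first by rewrite -/A -/B card_addpair_block /= negbK odG.
  by case/setD1P => _; apply: odG.
rewrite cover_setU1 !subUset sub1set aU sub1set bU /=; move: sG.
rewrite (coverE1 AG) subUset => /andP[sA sG].
have sU : U :\ a :\ b \subset U by apply: subset_trans (subsetDl _ _) (subsetDl _ _).
by rewrite (subset_trans sA sU) (subset_trans sG sU).
Qed.

Lemma card_cover_addpair : #|cover (addpair j a b G)| = #|cover G|.+2.
Proof.
have [tG AG jA _ dB] := addpair_block.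
rewrite cover_setU1 (coverE1 AG).
have dA := coverD1_disjoint AG tG.
rewrite (cardsU (_ :|: _)) (cardsU _ (cover _)) -/B -/A -/G'.
move: dB dA; rewrite -!setI_eq0 => /eqP-> /eqP->.
by rewrite cards0 !subn0 card_addpair_block.
Qed.

Lemma rempairK : rempair j a b (addpair j a b G) = G.
Proof.
rewrite /rempair pblock_addpair addpairE setU1K ?addpair_block_notin // /B setDUl.
have [_ AG _ _ _] := addpair_block.
rewrite setDv setU0 (setDidPl _) ?setD1K // disjoint_sym disjoints_subset.
by apply/subsetP=> i /set2P[]->; rewrite inE.
Qed.

End Add.

Section Rem.
Variable F : {set {set I}}.
Hypotheses (oF : oddfam U F) (jF : j \in cover F).
Let A := pblock F j.
Hypotheses (aA : a \in A) (bA : b \in A).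
Let B := A :\: [set a; b].
Let F' := F :\ A.

Lemma rempair_block :
  [/\ trivIset F, A \in F, j \in A, j \in B & [disjoint B & cover F']].
Proof.
case/oddfamP: oF => tF odF sF.
have AF : A \in F by apply: pblock_mem.
have jA : j \in A by rewrite mem_pblock.
split=> //; first by rewrite !inE negb_or jA andbT eq_sym aj eq_sym bj.
by apply: disjointWl (subsetDl _ _) _; apply: coverD1_disjoint.
Qed.

Lemma rempair_block_notin : B \notin F'.
Proof.
have [_ _ _ jB dB] := rempair_block; apply: fresh_block dB => //.
by apply/set0Pn; exists j.
Qed.

Lemma pblock_rempair : pblock (rempair j a b F) j = B.
Proof.
have [tG AG jA jB dB] := rempair_block; apply: def_pblock => //.
- exact: trivIset_swap.
- exact: setU11.
Qed.

Lemma addpairK : addpair j a b (rempair j a b F) = F.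
Proof.
rewrite /addpair pblock_rempair /rempair -/A -/F' -/B setU1K ?rempair_block_notin // /B.
have [_ AF _ _ _] := rempair_block.
have -> : A :\: [set a; b] :|: [set a; b] = A; last by rewrite setD1K.
apply/setP=> i; rewrite !inE; have [->|_] := eqVneq i a; first by rewrite aA.
by have [->|_] := eqVneq i b; rewrite ?bA ?orbF.
Qed.

Lemma cover_rempair : cover (rempair j a b F) = cover F :\ a :\ b.
Proof.
have [tF AF _ _ _] := rempair_block.
rewrite cover_setU1 (coverE1 AF) -/A -/F' -/B.
have dA := coverD1_disjoint AF tF.
apply/setP=> i; rewrite !inE.
have [->|_] /= := eqVneq i b; first by rewrite orbT /= (disjointFr dA bA).
have [->|_] //= := eqVneq i a; by rewrite (disjointFr dA aA).
Qed.

Lemma rempair_oddfam : oddfam (U :\ a :\ b) (rempair j a b F).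
Proof.
have [tF AF jA jB dB] := rempair_block; case/oddfamP: oF => _ odF sF.
apply/oddfamP; split; first exact: trivIset_swap.
- move=> C /setU1P[->|]; last by case/setD1P => _; apply: odF.
  rewrite cards_setDpair // oddB ?odF //.
  have <- : #|[set a; b]| = 2%N by rewrite cards2 ab.
  by apply: subset_leq_card; apply/subsetP=> i /set2P[]->.
- by rewrite cover_rempair !setSD.
Qed.

Lemma cover_rempair_j : j \in cover (rempair j a b F).
Proof. by rewrite cover_rempair !inE jF eq_sym bj eq_sym aj. Qed.

(** For a block of size [s], [(s-1)! = (s-1)(s-2)(s-3)!], and no other block changes; [s >= 3]
    because the block contains the distinct elements [j], [a] and [b]. *)
Lemma weight_rempair :
  weight F = (#|A|.-1 * #|A|.-2)%:R * weight (rempair j a b F).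
Proof.
clear aU bU.
have [tF AF jA jB dB] := rempair_block.
rewrite (weightE1 AF) [weight (rempair _ _ _ _)](weightE1 (setU11 _ _))
  setU1K ?rempair_block_notin //.
rewrite -/B -/F' mulrA; congr (_ * _); rewrite -natrM; congr _%:R.
rewrite cards_setDpair //.
have : (2 < #|A|)%N.
  have <- : #|[set j; a; b]| = 3%N.
    by rewrite setUC cardsU1 cards2 !inE negb_or bj (eq_sym b) ab (eq_sym j) aj.
  by apply: subset_leq_card; apply/subsetP=> i; rewrite !inE => /orP[/orP[]|] /eqP->.
by case: #|A| => [|[|[|s]]] //= _; rewrite !factS /=; nia.
Qed.
End Rem.

End Pair.

End OddFamilies.

Definition opair (I : finType) (V : {set I}) : {set I * I} :=
  [set p | [&& p.1 \in V, p.2 \in V & p.1 != p.2]].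

Lemma big_opair (R : nmodType) (I : finType) (V : {set I}) (f : I -> I -> R) :
  \sum_(p in opair V) f p.1 p.2 = \sum_(a in V) \sum_(b in V :\ a) f a b.
Proof.
rewrite (pair_big_dep (mem V) (fun a b => b \in V :\ a) f) /=.
by apply: eq_bigl => -[a b]; rewrite !inE /= (eq_sym b) (andbC (b \in V)).
Qed.

Lemma card_opair (I : finType) (V : {set I}) : #|opair V| = (#|V| * #|V|.-1)%N.
Proof.
rewrite -sum1_card (big_opair V (fun _ _ => 1%N)) /=.
rewrite (eq_bigr (fun=> #|V|.-1)) ?sum_nat_const // => a aV.
by rewrite sum1_card (cardsD1 a V) aV.
Qed.

(** * Splitting families at one element; total weight for a given number of covered elements *)

Section Sums.
Variables (R : realFieldType) (I : finType).
Implicit Types (U A B : {set I}) (F G : {set {set I}}).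

(** Since blocks are odd, excluding the singleton forces the block of [j] to have size at least
    3. *)
Definition bigfam U j F := [&& oddfam U F, j \in cover F & [set j] \notin F].

Lemma oddfamD1 U j F : oddfam (U :\ j) F = oddfam U F && (j \notin cover F).
Proof. by rewrite /oddfam subsetD1 -!andbA. Qed.

Lemma oddfam_addset1 U j F : j \in U -> oddfam (U :\ j) F ->
  oddfam U ([set j] |: F) && ([set j] \notin F).
Proof.
move=> jU; rewrite oddfamD1 => /andP[/oddfamP[tF oF sF] jF].
have nF : [set j] \notin F by apply: contra jF => /sub_cover; rewrite sub1set.
rewrite nF andbT; apply/oddfamP; split.
- by apply: trivIset_addblock; rewrite ?disjoints1.
- by move=> A /setU1P[->|/oF //]; rewrite cards1.
- by rewrite cover_setU1 subUset sub1set jU.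
Qed.

Lemma oddfam_remset1 U j F : oddfam U F -> [set j] \in F ->
  oddfam (U :\ j) (F :\ [set j]).
Proof.
move=> /oddfamP[tF oF sF] jF; rewrite oddfamD1 -disjoints1 coverD1_disjoint // andbT.
apply/oddfamP; split; first by apply: trivIsetS tF; apply: subsetDl.
  by move=> A /setD1P[_ /oF].
by apply: subset_trans sF; rewrite [cover F](coverE1 jF) subsetUr.
Qed.

(** Three fates of [j]: uncovered, a block of its own, or inside a larger block. The second is
    reindexed by deleting [[set j]], which leaves a family on [U :\ j]. *)
Lemma big_oddfam_split (V : nmodType) U j (f : {set {set I}} -> V) : j \in U ->
  \sum_(F | oddfam U F) f F =
    \sum_(F | oddfam (U :\ j) F) f F +
    (\sum_(F | oddfam (U :\ j) F) f ([set j] |: F) +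
    \sum_(F | bigfam U j F) f F).
Proof.
move=> jU; rewrite (bigID (fun F => j \notin cover F)) /=; congr (_ + _).
  by apply: eq_bigl => F; rewrite oddfamD1.
rewrite (bigID (fun F => [set j] \in F)) /=; congr (_ + _); last first.
  by apply: eq_bigl => F; rewrite negbK -andbA.
rewrite (reindex_onto (fun F => [set j] |: F) (fun F => F :\ [set j])) /=; last first.
  by move=> F /andP[_ jF]; rewrite setD1K.
apply: eq_bigl => F; rewrite negbK setU11 andbT.
have -> : j \in cover ([set j] |: F) by rewrite cover_setU1 !inE eqxx.
rewrite andbT; apply/andP/idP => [[oF /eqP e]|oF].
  by rewrite -e oddfam_remset1 ?setU11.
by have /andP[-> nF] := oddfam_addset1 jU oF; rewrite setU1K.
Qed.

(** A block of size [s] offers [(s-1)(s-2)] ordered pairs besides [j]. By [weight_rempair], removing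
    any of them divides the weight by exactly this number, so the reduced weights add up to the
    original one. *)
Lemma weight_sum_rempair U j F : bigfam U j F ->
  weight R F = \sum_(p in opair (pblock F j :\ j)) weight R (rempair j p.1 p.2 F).
Proof.
case/and3P=> oF jF jnF.
have jA : j \in pblock F j by rewrite mem_pblock.
have cA : #|pblock F j :\ j| = #|pblock F j|.-1 by rewrite (cardsD1 j (pblock F j)) jA.
have [/oddfamP[_ odF _] AF] : oddfam U F /\ pblock F j \in F by split; rewrite ?pblock_mem.
have c3 : (2 < #|pblock F j|)%N.
  have := odF _ AF; case E : #|pblock F j| => [|[|[|s]]] // _.
  by move/eqP/cards1P: E jnF jA AF => [i ->]; rewrite inE => /negP nF /eqP<-.
have s0 : (#|pblock F j|.-1 * #|pblock F j|.-2)%:R != 0 :> R.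
  by rewrite pnatr_eq0; move: c3; case: #|_| => [|[|[|s]]].
transitivity (\sum_(p in opair (pblock F j :\ j))
  weight R F / (#|pblock F j|.-1 * #|pblock F j|.-2)%:R).
  rewrite sumr_const card_opair cA -[RHS]mulr_natr mulfVK //.
apply: eq_bigr => -[a b]; rewrite !inE /= => /and3P[/andP[aj aA] /andP[bj bA] ab].
by rewrite (weight_rempair R aj bj ab oF jF aA bA) mulrC mulKf.
Qed.

(** Double counting of families with an ordered pair marked in the block of [j]: [addpair] and
    [rempair] are inverse, so the pair can be chosen first. Keeping [h] arbitrary lets the identity
    serve both the total weights and the sums of minima. *)
Lemma big_bigfam U j (h : {set {set I}} -> R) :
  \sum_(F | bigfam U j F) weight R F * h F =
  \sum_(p in opair (U :\ j)) \sum_(G | oddfam (U :\ p.1 :\ p.2) G && (j \in cover G))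
    weight R G * h (addpair j p.1 p.2 G).
Proof.
rewrite (eq_bigr (fun F => \sum_(p in opair (pblock F j :\ j))
   weight R (rempair j p.1 p.2 F) * h F)); last first.
  by move=> F /weight_sum_rempair {1}->; rewrite mulr_suml.
rewrite (exchange_big_dep (fun p => p \in opair (U :\ j))) /=; last first.
  move=> F [a b] /and3P[/oddfamP[tF odF sF] jF jnF]; rewrite !inE /=.
  have sA : pblock F j \subset U by apply: subset_trans sF; apply: sub_cover; apply: pblock_mem.
  by move=> /and3P[/andP[-> /(subsetP sA)->] /andP[-> /(subsetP sA)->] ->].
apply: eq_bigr => -[a b]; rewrite !inE /= => /and3P[/andP[aj aU] /andP[bj bU] ab].
rewrite (reindex_onto (addpair j a b) (rempair j a b)) /=; last first.
  move=> F /andP[/and3P[oF jF _]]; rewrite !inE /= => /and3P[/andP[_ aA] /andP[_ bA] _].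
  exact: (addpairK aj bj oF).
apply: eq_big => [G|G /andP[_ /eqP->] //].
apply/andP/andP=> [[/andP[/and3P[oF jF _]]]|[oG jG]].
  rewrite !inE /= => /and3P[/andP[_ aA] /andP[_ bA] _] /eqP <-.
  by rewrite (rempair_oddfam aj bj ab oF jF aA bA) (cover_rempair_j aj bj oF jF aA bA).
rewrite (rempairK ab oG jG) eqxx; split=> //; apply/andP; split; last first.
  by rewrite !inE /= (pblock_addpair oG jG) !inE !eqxx !orbT aj bj ab.
have oF := addpair_oddfam aU bU ab oG jG; apply/and3P; split=> //.
  by apply/bigcupP; exists (pblock G j :|: [set a; b]); rewrite ?setU11 // inE mem_pblock jG.
have jF : j \in pblock (addpair j a b G) j.
  by rewrite (pblock_addpair oG jG) inE mem_pblock jG.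
(* The block of [j] in [addpair j a b G] contains [a], so it is not [[set j]]. *)
apply/negP => nF; have /oddfamP[tF _ _] := oF.
have := def_pblock tF nF (set11 j); rewrite (pblock_addpair oG jG) => /setP/(_ a).
by rewrite !inE eqxx orbT (negbTE aj).
Qed.

Lemma oddfam0 F : oddfam set0 F = (F == set0).
Proof.
apply/idP/eqP => [oF|->]; last first.
  apply/oddfamP; split; first by apply/trivIsetP=> A B; rewrite inE.
    by move=> A; rewrite inE.
  by rewrite /cover big_set0.
apply/eqP; rewrite -subset0; apply/subsetP => A AF.
have := oddfam_set0 oF; case/oddfamP: oF => _ _; rewrite subset0 => /eqP cF.
by move/sub_cover: (AF); rewrite cF subset0 => /eqP A0; rewrite -A0 AF.
Qed.

Definition famweight U k : R := \sum_(F | oddfam U F) weight R F * (#|cover F| == k)%:R.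

Lemma weight_set1 U j F : oddfam (U :\ j) F -> j \in U ->
   weight R ([set j] |: F) = 2 * weight R F.
Proof.
move=> oF jU; have /andP[_ nF] := oddfam_addset1 jU oF.
by rewrite (weightE1 _ (setU11 _ _)) setU1K // cards1.
Qed.

Lemma card_cover_set1 U j F : oddfam (U :\ j) F -> #|cover ([set j] |: F)| = #|cover F|.+1.
Proof.
by rewrite oddfamD1 => /andP[_ nF]; rewrite cover_setU1 cardsU1 nF.
Qed.

(** In the third summand, the families covering [j] are all families minus those avoiding it, and
    inserting a pair raises the number of covered elements by 2, whence [k']. A block of size at
    least 3 cannot occur when only one element is covered. *)
Lemma famweight_rec U j k : j \in U ->
  famweight U k.+1 = famweight (U :\ j) k.+1 + (2 * famweight (U :\ j) k +
    if k is k'.+1 then \sum_(p in opair (U :\ j))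
      (famweight (U :\ p.1 :\ p.2) k' - famweight (U :\ p.1 :\ p.2 :\ j) k') else 0).
Proof.
move=> jU; rewrite {1}/famweight (big_oddfam_split _ jU); congr (_ + (_ + _)).
  rewrite mulr_sumr; apply: eq_bigr => F oF.
  by rewrite (weight_set1 oF jU) (card_cover_set1 oF) eqSS mulrA.
rewrite big_bigfam; case: k => [|k].
  rewrite big1 // => -[a b]; rewrite !inE /= => /and3P[/andP[aj aU] /andP[bj bU] ab].
  by rewrite big1 // => G /andP[oG jG]; rewrite (card_cover_addpair ab oG jG) mulr0.
apply: eq_bigr => -[a b]; rewrite !inE /= => /and3P[/andP[aj aU] /andP[bj bU] ab].
rewrite /famweight [X in _ = X - _](bigID (fun F => j \in cover F)) /=.
rewrite [X in _ = _ + X - _](eq_bigl (oddfam (U :\ a :\ b :\ j))); last first.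
  by move=> F; rewrite [RHS]oddfamD1.
rewrite addrK; apply: eq_bigr => G /andP[oG jG].
by rewrite (card_cover_addpair ab oG jG).
Qed.

Lemma famweight0 U : famweight U 0 = 1.
Proof.
rewrite /famweight (bigD1 set0) /=; last first.
  apply/oddfamP; split; first by apply/trivIsetP=> A B; rewrite inE.
    by move=> A; rewrite inE.
  by rewrite /cover big_set0 sub0set.
rewrite /weight /cover !big_set0 cards0 mulr1 big1 ?addr0 // => F /andP[oF F0].
have /negbTE c0 : cover F != set0; last by rewrite cards_eq0 c0 mulr0.
apply: contra F0 => /eqP cF; rewrite -oddfam0.
by case/oddfamP: oF => tF oF _; apply/oddfamP; rewrite cF.
Qed.

(** In terms of cycles this is the expansion [exp(2 artanh t) = (1+t)/(1-t) = 1 + 2t + 2t^2 + ...]: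
    each nonempty [k]-set carries total weight [2 k!]. The empty set carries 1 instead of 2, hence
    the index [k.+1]. *)
Lemma famweightE U k : famweight U k.+1 = (2 * #|U| ^_ k.+1)%:R.
Proof.
elim: {U}_.+1 {-2}U (ltnSn #|U|) k => // n IH U; rewrite ltnS => leUn k.
have [->|[j jU]] := set_0Vmem U.
  rewrite /famweight cards0 ffact_small // muln0 (big_pred1 set0) ?oddfam0 //=.
    by rewrite /cover big_set0 cards0 mulr0.
  by move=> F; rewrite oddfam0.
have cU := cardsD1 j U; rewrite jU add1n in cU.
rewrite (famweight_rec _ jU) IH -?cU //.
(* For the first two values of [k] the recursion reaches back to [famweight _ 0], where the closed
   formula fails. *)
case: k => [|[|k]].
- by rewrite famweight0 cU !ffactn1 !addr0 -[2 * 1]/(2 * 1%:R) -natrM -natrD; congr _%:R; lia.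
- rewrite big1; last by move=> p _; rewrite !famweight0 subrr.
  rewrite IH -?cU // cU addr0 -[2 * _]natrM -natrD; congr _%:R.
  by rewrite !ffactnS !ffactn0; case: #|U :\ j| => [|s] /=; nia.
rewrite (eq_bigr (fun=> (2 * (#|U| - 2) ^_ k.+1)%:R - (2 * (#|U| - 3) ^_ k.+1)%:R)); last first.
  move=> -[a b]; rewrite !inE /= => /and3P[/andP[aj aU] /andP[bj bU] ab].
  have c2 : #|U :\ a :\ b| = (#|U| - 2)%N.
    have := cardsD1 a U; have := cardsD1 b (U :\ a); rewrite !inE eq_sym ab aU bU /=; lia.
  have c3 : #|U :\ a :\ b :\ j| = (#|U| - 3)%N.
    have := cardsD1 j (U :\ a :\ b); rewrite !inE eq_sym bj eq_sym aj jU /=; lia.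
  have ? : (0 < #|U :\ a :\ b|)%N.
    by apply/card_gt0P; exists j; rewrite !inE eq_sym bj eq_sym aj jU.
  rewrite !IH ?c2 ?c3 //; lia.
rewrite sumr_const card_opair IH -?cU // cU.
(* Ground sets of size 1 and 2 are set apart, so that afterwards [#|U| - 2] and [#|U| - 3] are not
   truncated. *)
case: #|U :\ j| => [|s] /=.
  by rewrite !ffact_small // muln0 !mulr0 mul0n mulr0n !addr0.
case: s => [|s].
  by rewrite !ffact_small // !muln0 mulr0n !mulr0 !addr0.
rewrite !subSS !subn0 -[X in _ + (_ + X)]mulr_natl 4![_.+1 ^_ _]ffactSS.
move: (s ^_ k.+1) => y; rewrite !ffactSS; move: (s ^_ k) => z.
by rewrite !natrM -!natr1; ring.
Qed.
End Sums.

(** * The closed form as a sum over families *)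

Section Minsum.
Variables (R : realFieldType) (n : nat).
Implicit Types (x y : 'I_n -> R) (A : {set 'I_n}) (F G : {set {set 'I_n}}).

Lemma bigmin_seq_le (d : R) (l : seq R) v :
  v \in d :: l -> \big[Order.min/d]_(u <- l) u <= v.
Proof.
elim: l => [|u l IH]; first by rewrite inE => /eqP->; rewrite big_nil.
rewrite big_cons ge_min !inE => /or3P[vd|/eqP->|vl].
- by rewrite IH ?orbT // inE vd.
- by rewrite lexx.
- by rewrite IH ?orbT // inE vl orbT.
Qed.

Lemma bigmin_seq_mem (d : R) (l : seq R) : \big[Order.min/d]_(u <- l) u \in d :: l.
Proof.
elim: l => [|u l IH]; first by rewrite big_nil mem_head.
rewrite big_cons; case: (leP u) => _; first by rewrite !inE eqxx orbT.
by move: IH; rewrite !inE => /orP[]->; rewrite ?orbT.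
Qed.

Lemma minsum_le x F A : A \in F -> minsum x F <= \sum_(i in A) x i.
Proof.
by move=> AF; apply: bigmin_seq_le; rewrite inE map_f ?orbT // mem_enum.
Qed.

Lemma minsum_mem x F : F != set0 ->
  exists2 A, A \in F & minsum x F = \sum_(i in A) x i.
Proof.
case/set0Pn=> A AF; rewrite /minsum; set l := map _ _.
have : \big[Order.min/head 0 l]_(v <- l) v \in l.
  (* The fold starts at [head 0 l], which belongs to [l] as soon as [l] is nonempty. *)
  have := bigmin_seq_mem (head 0 l) l; rewrite inE => /orP[/eqP->|//].
  have : size l != 0%N by rewrite size_map -cardE -lt0n; apply/card_gt0P; exists A.
  by case: (l) => // u l' _; rewrite mem_head.
by case/mapP => B; rewrite mem_enum; exists B.
Qed.

Lemma minsum0 x : minsum x set0 = 0.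
Proof. by rewrite /minsum enum_set0 /= big_nil. Qed.

Lemma minsum_eq x F A : A \in F ->
  (forall B, B \in F -> \sum_(i in A) x i <= \sum_(i in B) x i) ->
  minsum x F = \sum_(i in A) x i.
Proof.
move=> AF leA; apply/le_anti; rewrite minsum_le //=.
by have [|B BF ->] := @minsum_mem x F; [apply/set0Pn; exists A | apply: leA].
Qed.

(** The minimum depends only on the set of block sums, so it can be compared across different
    families and different gap functions. *)
Lemma minsum_transfer x y F G :
  (forall A, A \in F -> exists2 B, B \in G & \sum_(i in A) x i = \sum_(i in B) y i) ->
  (forall B, B \in G -> exists2 A, A \in F & \sum_(i in A) x i = \sum_(i in B) y i) ->
  minsum x F = minsum y G.
Proof.
move=> FG GF; have [F0|[A0 AF0]] := set_0Vmem F.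
  have [->|[B BG]] := set_0Vmem G; first by rewrite F0 !minsum0.
  by have [A] := GF _ BG; rewrite F0 inE.
have [|A AF eA] := @minsum_mem x F; first by apply/set0Pn; exists A0.
have [B BG eB] := FG _ AF.
rewrite eA eB; apply/esym/minsum_eq => // C CG.
by have [A' AF' <-] := GF _ CG; rewrite -eB -eA minsum_le.
Qed.
End Minsum.

(** * The recursion satisfied by the closed form *)

Section OddSum.
Variables (R : realFieldType) (n : nat).
Implicit Types (x y : 'I_n -> R) (U A B : {set 'I_n}) (F G : {set {set 'I_n}}).
Implicit Types (i j a b : 'I_n).

(* Merging keeps the label [j] for the new gap; [a] and [b] leave the ground set. *)
Definition merge_gap x j a b : 'I_n -> R := fun i => if i == j then x a + x j + x b else x i.

(** The factor of [P(o) / |Phi(o,x)|] that depends only on [N] and [k]; the other factor is the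
    [weight] of any family of type [o] (see [Pw_card_Phi]). *)
Definition coef (N k : nat) : R := (N - k)`!%:R / (2 * N`!%:R).

(** [N] is kept apart from [F] because the recursion weighs one family relative to ground sets of
    sizes [N.+2] and [N]. The empty family contributes 0, as its [minsum] is 0; this agrees with [k]
    starting at 2. *)
Definition evenmin x N F : R :=
  if odd #|cover F| then 0 else coef N #|cover F| * minsum x F.

Definition oddsum x U := \sum_(F | oddfam U F) weight R F * evenmin x #|U| F.

Lemma fact_neq0 N : N`!%:R != 0 :> R.
Proof. by rewrite pnatr_eq0 -lt0n fact_gt0. Qed.

Lemma natrS_neq0 N : N.+1%:R != 0 :> R.
Proof. by rewrite pnatr_eq0. Qed.

Lemma coefSS N k : (N.+2 * N.+1)%:R * coef N.+2 k.+2 = coef N k.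
Proof.
rewrite /coef !subSS !factS !natrM.
move: (fact_neq0 N) (natrS_neq0 N) (natrS_neq0 N.+1).
move: (N`!%:R) (N.+1%:R) (N.+2%:R) => u v w hu hv hw.
by field; rewrite hu hv hw.
Qed.

(** The integer on the right is the number of times a family avoiding [j] with [k] covered gaps
    arises in the recursion: once for each ordered pair of other uncovered gaps and twice for each
    single one. *)
Lemma coefS2 N k : (k <= N)%N ->
  (N.+2 * N.+1)%:R * coef N.+2 k = ((N.+1 - k) * (N - k) + 2 * (N.+1 - k))%:R * coef N k.
Proof.
move=> kN; rewrite /coef !subSn // ?leqW //.
have -> : ((N - k).+1 * (N - k) + 2 * (N - k).+1 = (N - k).+2 * (N - k).+1)%N by lia.
rewrite !factS !natrM.
move: (fact_neq0 N) (natrS_neq0 N) (natrS_neq0 N.+1).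
move: (N`!%:R) (N.+1%:R) (N.+2%:R) => u v w hu hv hw.
by field; rewrite hu hv hw.
Qed.

(** The value does not depend on [k]: among the families having [{j}] as a block, each odd number
    [k] of other covered gaps gets the same share. *)
Lemma coef_famweight N k : (k <= N)%N -> coef N.+1 k.+1 * (2 * (2 * N ^_ k)%:R) = 2 / N.+1%:R.
Proof.
move=> kN; rewrite /coef subSS factS -(ffact_fact kN) !natrM.
have h3 : (N ^_ k)%:R != 0 :> R by rewrite pnatr_eq0 -lt0n ffact_gt0.
move: (fact_neq0 (N - k)) (natrS_neq0 N) h3.
move: ((N - k)`!%:R) (N.+1%:R) ((N ^_ k)%:R) => u v w hu hv hw.
by field; rewrite hu hv hw.
Qed.

Lemma sum_odd_ord m : \sum_(k < m.*2) (odd k : nat) = m.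
Proof.
elim: m => [|m IH]; first by rewrite big_ord0.
by rewrite doubleS !big_ord_recr /= IH odd_double /=; lia.
Qed.

Lemma merge_sumE x A j a b : j \in A -> a \notin A -> b \notin A -> a != b ->
  \sum_(i in A) merge_gap x j a b i = \sum_(i in A :|: [set a; b]) x i.
Proof.
move=> jA aA bA ab; rewrite [RHS](big_setID A) /= (setIidPr (subsetUl _ _)).
have -> : (A :|: [set a; b]) :\: A = [set a; b].
  rewrite setDUl setDv set0U; apply/setDidPl; rewrite disjoint_sym disjoints_subset.
  by apply/subsetP=> i iA; rewrite !inE negb_or; apply/andP; split; apply: contraTneq iA => ->.
rewrite big_setU1 ?inE // big_set1 !(big_setD1 j jA) /= /merge_gap eqxx.
rewrite (eq_bigr x) => [|i /setD1P[/negbTE-> _]] //; ring.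
Qed.

Lemma merge_sum_out x A j a b : j \notin A ->
  \sum_(i in A) merge_gap x j a b i = \sum_(i in A) x i.
Proof.
by move=> jA; apply: eq_bigr => i iA; rewrite /merge_gap; case: eqP jA => // <-; rewrite iA.
Qed.

Lemma minsum_merge_out x F j a b : j \notin cover F ->
  minsum (merge_gap x j a b) F = minsum x F.
Proof.
move=> jF; have e A : A \in F -> \sum_(i in A) merge_gap x j a b i = \sum_(i in A) x i.
  by move=> AF; apply: merge_sum_out; apply: contra jF => jA; apply/bigcupP; exists A.
by apply: minsum_transfer => A AF; exists A; rewrite ?e.
Qed.

Lemma minsum_addpair x U G j a b : a != b -> oddfam (U :\ a :\ b) G -> j \in cover G ->
  minsum x (addpair j a b G) = minsum (merge_gap x j a b) G.
Proof.
move=> ab oG jG; have [tG AG jA /andP[na nb] dB] := addpair_block oG jG.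
have out C : C \in G -> (a \notin C) && (b \notin C).
  by move=> /sub_cover/subsetP sC; apply/andP; split;
    [apply: contra na|apply: contra nb]; apply: sC.
have eA := merge_sumE x jA _ _ ab; have /andP[aA bA] := out _ AG.
have e C : C \in G :\ pblock G j -> \sum_(i in C) merge_gap x j a b i = \sum_(i in C) x i.
  move=> CG; apply: merge_sum_out; apply/negP => jC.
  case/setD1P: CG => /eqP nC CG; apply: nC; apply/esym; exact: def_pblock.
apply: minsum_transfer => C.
  case/setU1P=> [->|CG]; first by exists (pblock G j); rewrite // eA.
  by exists C; [case/setD1P: CG|rewrite e].
move=> CG; have [->|nC] := eqVneq C (pblock G j).
  by exists (pblock G j :|: [set a; b]); rewrite ?setU11 // eA.
by exists C; rewrite ?e // !inE ?nC ?CG ?orbT.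
Qed.

(** Any other block is nonempty and consists of positive gaps, each at least [x j]. *)
Lemma minsum_set1 x U F j : (forall i, i \in U -> 0 < x i) -> j \in U ->
  (forall i, i \in U -> x j <= x i) -> oddfam (U :\ j) F ->
  minsum x ([set j] |: F) = x j.
Proof.
move=> px jU minj /(oddfam_addset1 jU)/andP[oF _].
rewrite (@minsum_eq _ _ _ _ [set j]) ?setU11 ?big_set1 // => B BF.
have B0 : B != set0 by apply: contraTneq BF => ->; apply: oddfam_set0 oF.
have sB : B \subset U by case/oddfamP: oF => _ _; apply: subset_trans; apply: sub_cover.
have [i iB] := set0Pn _ B0; rewrite (big_setD1 i) //=.
have iU := subsetP sB _ iB; apply: le_trans (minj _ iU) _; rewrite lerDl.
by apply: sumr_ge0 => l /setD1P[_ lB]; rewrite ltW // px // (subsetP sB).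
Qed.

(** All minima here are [x j]. Each odd number [k] of other covered gaps contributes [2 / #|U|]
    times [x j] by [coef_famweight], and [k] has [#|U| / 2] odd values. *)
Lemma evenmin_set1_sum x U j : (forall i, i \in U -> 0 < x i) -> j \in U ->
  (forall i, i \in U -> x j <= x i) -> ~~ odd #|U| ->
  \sum_(F | oddfam (U :\ j) F) weight R ([set j] |: F) * evenmin x #|U| ([set j] |: F) = x j.
Proof.
move=> px jU minj evU; have cU := cardsD1 j U; rewrite jU add1n in cU.
pose m := #|U|./2; have em : #|U| = m.*2 by rewrite -[LHS]odd_double_half (negbTE evU).
transitivity (\sum_(F | oddfam (U :\ j) F) \sum_(k < m.*2 | k == #|cover F| :> nat)
   (if odd k then weight R F * (2 * coef #|U| k.+1 * x j) else 0)).
  apply: eq_bigr => F oF.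
  have lt : (#|cover F| < m.*2)%N.
    by rewrite -em cU ltnS; apply: subset_leq_card; case/oddfamP: oF.
  rewrite (big_pred1 (Ordinal lt)) //= (weight_set1 _ oF jU) /evenmin (card_cover_set1 oF) /=.
  rewrite if_neg; case: ifP => _; last by rewrite mulr0.
  by rewrite (minsum_set1 px jU minj oF); ring.
rewrite (exchange_big_dep predT) //=.
transitivity (\sum_(k < m.*2) (2 / #|U|%:R * x j) *+ (odd k)); last first.
  rewrite sumrMnr sum_odd_ord -mulr_natr em -muln2 natrM.
  have : m%:R != 0 :> R by rewrite pnatr_eq0; apply: contra_eqN cU => /eqP m0; rewrite em m0.
  by move=> h; field.
apply: eq_bigr => k _; case ok: (odd k); last by rewrite big1.
rewrite mulr1n -(mulr_suml _ _ _ (2 * coef #|U| k.+1 * x j)).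
have -> : \sum_(F | oddfam (U :\ j) F && (k == #|cover F| :> nat)) weight R F
    = (2 * #|U :\ j| ^_ k)%:R.
  rewrite -[k : nat]prednK ?odd_gt0 // -famweightE /famweight big_mkcondr /=.
  by apply: eq_bigr => F _; rewrite prednK ?odd_gt0 // eq_sym; case: eqP; rewrite (mulr0, mulr1).
have kU : (k <= #|U :\ j|)%N by rewrite -ltnS -cU em.
by rewrite cU -(coef_famweight kU); ring.
Qed.

Lemma oddsum_rec x U j : (forall i, i \in U -> 0 < x i) -> j \in U ->
  (forall i, i \in U -> x j <= x i) -> ~~ odd #|U| ->
  (#|U| * #|U|.-1)%:R * oddsum x U = (#|U| * #|U|.-1)%:R * x j +
    (\sum_(p in opair (U :\ j)) oddsum (merge_gap x j p.1 p.2) (U :\ p.1 :\ p.2) +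
     2 * \sum_(a in U :\ j) oddsum x (U :\ j :\ a)).
Proof.
move=> px jU minj evU; have cU := cardsD1 j U; rewrite jU add1n in cU.
have [N cN] : exists N, #|U| = N.+2.
  by move: evU; rewrite cU; case: #|_| => [|N] // _; exists N.
have cUj : #|U :\ j| = N.+1 by move: cU; rewrite cN => -[].
rewrite {1}/oddsum (big_oddfam_split _ jU) (evenmin_set1_sum px jU minj evU).
rewrite big_bigfam cN /= addrCA mulrDr; congr (_ + _).
have card2 p : p \in opair (U :\ j) -> #|U :\ p.1 :\ p.2| = N.
  case: p => a b; rewrite !inE /= => /and3P[/andP[aj aU] /andP[bj bU] ab].
  have := cardsD1 a U; have := cardsD1 b (U :\ a); rewrite !inE eq_sym ab aU bU cN /=; lia.
rewrite mulrDr.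
(* The merged terms are split by whether [j] is covered. If not, merging leaves the minimum
   unchanged; if so, [addpair] and [coefSS] turn them into the families with a block of size at
   least 3 at [j]. *)
have -> : \sum_(p in opair (U :\ j)) oddsum (merge_gap x j p.1 p.2) (U :\ p.1 :\ p.2) =
  \sum_(p in opair (U :\ j)) \sum_(F | oddfam (U :\ p.1 :\ p.2) F && (j \notin cover F))
     weight R F * evenmin x N F +
  (N.+2 * N.+1)%:R * \sum_(p in opair (U :\ j))
   \sum_(G | oddfam (U :\ p.1 :\ p.2) G && (j \in cover G))
    weight R G * evenmin x N.+2 (addpair j p.1 p.2 G).
  rewrite mulr_sumr -big_split /=; apply: eq_bigr => -[a b] pV; have /= c2 := card2 _ pV.
  move: pV; rewrite !inE /= => /and3P[/andP[aj aU] /andP[bj bU] ab].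
  rewrite /oddsum c2 (bigID (fun F => j \notin cover F)) /= mulr_sumr; congr (_ + _).
    by apply: eq_bigr => F /andP[oF jF]; rewrite /evenmin minsum_merge_out.
  apply: eq_big => [F|F]; first by rewrite negbK.
  rewrite negbK => /andP[oF jF].
  rewrite /evenmin (card_cover_addpair ab oF jF) /= negbK (minsum_addpair x ab oF jF).
  by case: ifP => _; rewrite ?mulr0 // -(coefSS N); ring.
rewrite [RHS]addrAC; congr (_ + _).
(* Only families avoiding [j] remain. Both sums are regrouped by family, so that it suffices to
   count the choices of [a] and [b] outside the cover. *)
rewrite (exchange_big_dep (oddfam (U :\ j))) /=; last first.
  move=> p F _ /andP[/oddfamP[tF oF sF] jF]; rewrite oddfamD1 jF andbT.
  by apply/oddfamP; split=> //; apply: subset_trans sF (subset_trans (subsetDl _ _) (subsetDl _ _)).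
have -> : \sum_(a in U :\ j) oddsum x (U :\ j :\ a) =
  \sum_(F | oddfam (U :\ j) F) \sum_(a in U :\ j | oddfam (U :\ j :\ a) F)
     weight R F * evenmin x N F.
  rewrite [RHS](exchange_big_dep (fun a => a \in U :\ j)) /=; last by move=> ? ? _ /andP[].
  apply: eq_bigr => a aU.
  rewrite /oddsum; have -> : #|U :\ j :\ a| = N.
    by have := cardsD1 a (U :\ j); rewrite aU cUj => -[].
  apply: eq_bigl => F; rewrite aU /=.
  by apply/idP/andP => [h|[]//]; split=> //; move: h; rewrite oddfamD1 => /andP[].
rewrite !mulr_sumr -big_split /=; apply: eq_bigr => F oF.
have sF : cover F \subset U :\ j by case/oddfamP: oF.
have cV : #|U :\ j :\: cover F| = (N.+1 - #|cover F|)%N by rewrite cardsDS // cUj.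
rewrite (eq_bigl (mem (opair (U :\ j :\: cover F)))); last first.
  move=> [a b]; rewrite /= !inE /=; move: oF; rewrite !oddfamD1 => /andP[-> ->] /=.
  by case: (a == j); case: (b == j); case: (a \in cover F); case: (b \in cover F);
     rewrite ?andbF ?andbT.
rewrite [X in _ = _ + 2 * X](eq_bigl (mem (U :\ j :\: cover F))); last first.
  move=> a; rewrite /= [oddfam _ _]oddfamD1 oF !inE /=.
  by rewrite andbC.
rewrite !sumr_const card_opair cV /evenmin.
case: ifP => ev; first by rewrite !mulr0 !mul0rn mulr0 addr0.
(* [cover F] has even size and lies in a set of odd size [N.+1], so it cannot fill it. *)
have kN : (#|cover F| <= N)%N.
  have := subset_leq_card sF; rewrite cUj leq_eqVlt => /orP[/eqP e|//].
  by move: evU; rewrite cN /= negbK -[N in odd N]/(N.+1.-1) -e; move: ev; rewrite e /= => /negbFE->.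
have -> : (N.+1 - #|cover F|).-1 = (N - #|cover F|)%N by rewrite subSn.
rewrite -![(_ * _) *+ _]mulr_natl; set k := #|cover F|.
have := coefS2 kN; rewrite -/k natrD [(2 * _)%:R]natrM => e.
transitivity (weight R F * minsum x F * ((N.+2 * N.+1)%:R * coef N.+2 k)); first by ring.
by rewrite e; ring.
Qed.

End OddSum.

(** * Random arrangements *)

Section Permutations.
Variables (V : nmodType) (I : finType).
Implicit Types (U : {set I}) (G : seq I -> V) (j a b c : I).

Local Notation perms U := (permutations (enum (mem U))).

Lemma big_perms0 G : \sum_(t <- perms (set0 : {set I})) G t = G [::].
Proof. by rewrite enum_set0 big_seq1. Qed.

Lemma big_perms_cons U G : U != set0 ->
  \sum_(t <- perms U) G t = \sum_(a in U) \sum_(t <- perms (U :\ a)) G (a :: t).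
Proof.
move=> U0; rewrite (perm_big _ (permutationsE _)) -?cardE ?card_gt0 //.
rewrite big_allpairs_dep undup_id ?enum_uniq // big_enum /=.
apply: eq_bigr => a aU; apply: perm_big; apply: perm_permutations.
apply: uniq_perm; rewrite ?rem_uniq ?enum_uniq // => i.
by rewrite mem_rem_uniq ?enum_uniq // !inE !mem_enum !inE.
Qed.

(** Undoes a merge on a sequence of labels: the merged gap, which kept the label [j], is opened into
    [a], [j], [b]. *)
Definition insert_around j a b (t : seq I) : seq I :=
  flatten [seq (if c == j then [:: a; j; b] else [:: c]) | c <- t].

Lemma insert_around_notin j a b t : j \notin t -> insert_around j a b t = t.
Proof.
elim: t => //= c t IH; rewrite inE negb_or eq_sym => /andP[/negbTE cj jt].
by rewrite /insert_around /= cj -/(insert_around j a b t) IH.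
Qed.

Lemma insert_around_cat j a b l r : j \notin l -> j \notin r ->
  insert_around j a b (l ++ j :: r) = l ++ [:: a, j, b & r].
Proof.
move=> jl jr; rewrite /insert_around map_cat flatten_cat /= eqxx.
by rewrite -!/(insert_around _ _ _ _) !insert_around_notin.
Qed.

Lemma exchange_bigD1 U (f : I -> I -> V) :
  \sum_(a in U) \sum_(b in U :\ a) f a b = \sum_(b in U) \sum_(a in U :\ b) f a b.
Proof.
rewrite (exchange_big_dep (fun b => b \in U)) /=; last by move=> a b _ /setD1P[].
apply: eq_bigr => b bU; apply: eq_bigl => a.
by rewrite !inE bU andbT eq_sym andbC.
Qed.

Lemma mem_perms U t : t \in perms U -> uniq t /\ t =i U.
Proof.
rewrite mem_permutations => pt; rewrite (perm_uniq pt) enum_uniq; split=> // i.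
by rewrite (perm_mem pt) mem_enum.
Qed.

(** The position of [j] decides: first with right neighbour [a], last with left neighbour [a], or
    between [a] and [b]. The induction removes the first label [c]; when the rest starts with [j],
    then [j] stands between [c] and its successor. *)
Lemma big_perms_split U j G : j \in U -> (1 < #|U|)%N ->
  \sum_(t <- perms U) G t =
  \sum_(a in U :\ j) \sum_(t <- perms (U :\ j :\ a)) (G [:: j, a & t] + G (t ++ [:: a; j])) +
  \sum_(p in opair (U :\ j)) \sum_(t <- perms (U :\ p.1 :\ p.2)) G (insert_around j p.1 p.2 t).
Proof.
elim: {U}_.+1 {-2}U (ltnSn #|U|) G => // n IH U; rewrite ltnS => leUn G jU U1.
have ne (A : {set I}) : (0 < #|A|)%N -> A != set0 by rewrite card_gt0.
rewrite big_perms_cons; last by apply: ne; apply: ltnW.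
have cU := cardsD1 j U; rewrite jU add1n in cU.
rewrite (big_setD1 j jU) /= big_perms_cons; last by apply: ne; rewrite -ltnS -cU.
under [X in _ = X + _]eq_bigr do rewrite big_split /=.
rewrite big_split /= -addrA; congr (_ + _).
(* With two labels in all, removing the first leaves too few for the induction hypothesis. *)
have [c1|c1] := leqP #|U :\ j| 1.
  have /cards1P[a Ua] : #|U :\ j| == 1%N by rewrite eqn_leq c1 -ltnS -cU.
  have [aj aU] : a != j /\ a \in U by apply/andP; have := set11 a; rewrite -Ua !inE.
  have Uaj : U :\ a = [set j] by rewrite -(setD1K jU) Ua setUC setU1K // inE.
  rewrite Ua !big_set1 setDv Uaj big_perms0 enum_set1 big_seq1 big1 ?addr0 // => -[b c].
  by rewrite !inE /= => /and3P[/eqP-> /eqP->]; rewrite eqxx.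
have swap (A : {set I}) a b : A :\ a :\ b = A :\ b :\ a.
  by rewrite !setDDl setUC.
(* The induction hypothesis on [U :\ c], in the order: [j] right after [c], [j] last, [j] further
   inside. *)
rewrite (eq_bigr (fun c =>
  \sum_(a in U :\ j :\ c) \sum_(t <- perms (U :\ j :\ c :\ a)) G [:: c, j, a & t] +
  (\sum_(a in U :\ j :\ c) \sum_(t <- perms (U :\ j :\ c :\ a)) G (c :: t ++ [:: a; j]) +
   \sum_(a in U :\ j :\ c) \sum_(b in U :\ j :\ c :\ a) \sum_(t <- perms (U :\ c :\ a :\ b))
      G (c :: insert_around j a b t)))); last first.
  move=> c; rewrite !inE => /andP[cj cU'].
  have cUc := cardsD1 c U; rewrite cU' add1n in cUc.
  have ltn : (#|U :\ c| < n)%N by rewrite -cUc.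
  have jUc : j \in U :\ c by rewrite !inE eq_sym cj.
  have c2 : (1 < #|U :\ c|)%N by rewrite -ltnS -cUc cU ltnS.
  rewrite (IH _ ltn _ jUc c2).
  rewrite (swap U c j) (big_opair _ (fun a b => \sum_(t <- perms (U :\ c :\ a :\ b))
      G (c :: insert_around j a b t))) addrA -!big_split /=.
  by apply: eq_bigr => a _; rewrite big_split.
rewrite !big_split /= addrCA; congr (_ + _).
  rewrite [RHS](eq_bigr (fun a => \sum_(c in U :\ j :\ a)
     \sum_(t <- perms (U :\ j :\ a :\ c)) G (c :: t ++ [:: a; j]))); last first.
    move=> a aU; rewrite big_perms_cons //; apply: ne.
    by move: c1; rewrite (cardsD1 a (U :\ j)) aU.
  rewrite exchange_bigD1; apply: eq_bigr => a _; apply: eq_bigr => c _.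
  by rewrite swap.
rewrite (big_opair _ (fun a b => \sum_(t <- perms (U :\ a :\ b)) G (insert_around j a b t))).
(* The contracted arrangement is expanded by its first label: it is [j], which opens to [a, j, b] in
   front, or some other [c]. *)
rewrite [RHS](eq_bigr (fun a =>
  \sum_(b in U :\ j :\ a) \sum_(t <- perms (U :\ j :\ a :\ b)) G [:: a, j, b & t] +
  \sum_(b in U :\ j :\ a) \sum_(c in U :\ j :\ a :\ b)
     \sum_(t <- perms (U :\ c :\ a :\ b)) G (c :: insert_around j a b t))); last first.
  move=> a /setD1P[aj aU]; rewrite -big_split; apply: eq_bigr => b.
  rewrite !inE => /and3P[ba bj bU] /=.
  have jab : j \in U :\ a :\ b by rewrite !inE eq_sym bj eq_sym aj.
  have e : U :\ a :\ b :\ j = U :\ j :\ a :\ b by rewrite (swap _ b) (swap _ a).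
  rewrite big_perms_cons ?(big_setD1 j jab) /=; last by apply/set0Pn; exists j.
  rewrite e; congr (_ + _).
    apply: eq_big_seq => t /mem_perms[_ tU].
    rewrite (@insert_around_cat j a b [::]) //= tU !inE eqxx ?andbF //.
  apply: eq_bigr => c; rewrite !inE => /and4P[cb ca cj cU'].
  rewrite (swap (U :\ a) b c) (swap U a c); apply: eq_bigr => t _.
  by rewrite /insert_around /= (negbTE cj).
rewrite big_split; congr (_ + _); rewrite exchange_bigD1; apply: eq_bigr => a _.
rewrite -[RHS]exchange_bigD1; apply: eq_bigr => c _.
by rewrite swap.
Qed.

End Permutations.

(** * Average greedy cost of a sequence of gaps *)

Section GapCost.
Variable R : realFieldType.
Implicit Types (g : seq R).

(* Effect on the gap sequence of deleting the two endpoints of gap [i]. *)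
Definition contract (i : nat) g : seq R :=
  if i is i'.+1 then
    if i.+1 == size g then take i' g
    else take i' g ++ (g`_i' + g`_i + g`_i.+1) :: drop i.+2 g
  else drop 2 g.

Definition amin g (i : nat) : bool := all (fun v => g`_i <= v) g.

(** The first sum counts the ties. On the empty sequence it is 0, and [0^-1 = 0] makes the cost 0,
    as in the stopping case of [greedyE]. *)
Fixpoint gcost (fuel : nat) g : R :=
  if fuel is f.+1 then
    (\sum_(0 <= i < size g | amin g i) 1)^-1 *
    \sum_(0 <= i < size g | amin g i) (g`_i + gcost f (contract i g))
  else 0.

Lemma contract_cat_last g (a b : R) : contract (size g).+1 (g ++ [:: a; b]) = g.
Proof. by rewrite /= size_cat addn2 eqxx take_size_cat. Qed.

Lemma contract_cat g (a b c : R) r :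
  contract (size g).+1 (g ++ [:: a, b, c & r]) = g ++ (a + b + c) :: r.
Proof.
rewrite /contract size_cat /= ifN; last by lia.
have nthD k s : (g ++ s)`_(size g + k) = s`_k.
  by rewrite nth_cat ltnNge leq_addr addKn.
have := nthD 0 [:: a, b, c & r]; rewrite take_size_cat // addn0 => ->.
rewrite -(addn3 (size g)) addnC -drop_drop drop_size_cat //.
by rewrite -(addn2 (size g)) -(addn1 (size g)) !nthD /= drop0.
Qed.

Variable n : nat.
Implicit Types (x : 'I_n -> R) (U : {set 'I_n}) (t : seq 'I_n).

Lemma contract_mid x j a b l r : j \notin l -> j \notin r ->
  contract (size l).+1 (map x (l ++ [:: a, j, b & r])) = map (merge_gap x j a b) (l ++ j :: r).
Proof.
move=> jl jr; rewrite !map_cat -(size_map x l) !map_cons contract_cat {2}/merge_gap eqxx.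
have e s : j \notin s -> map x s = map (merge_gap x j a b) s.
  by move=> js; apply/eq_in_map => i si; rewrite /merge_gap; case: eqP si js => // -> ->.
by rewrite !e.
Qed.

Definition argmin x U j := [forall i in U, x j <= x i].

(** Passes from positions to labels: the set of shortest gaps then no longer depends on the
    arrangement, and the sums over gaps and arrangements can be exchanged. *)
Lemma big_amin (V : nmodType) x U t (H : R -> nat -> V) : uniq t -> t =i U ->
  \sum_(0 <= i < size (map x t) | amin (map x t) i) H (map x t)`_i i =
  \sum_(j in U | argmin x U j) H (x j) (index j t).
Proof.
move=> ut tU.
have pt : perm_eq (enum U) t by apply: uniq_perm; rewrite ?enum_uniq // => i; rewrite mem_enum tU.
rewrite -big_enum_cond (perm_big _ pt) /=.
have am j : all (fun v => x j <= v) (map x t) = argmin x U j.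
  rewrite all_map; apply/allP/forall_inP => h i; first by rewrite -tU; apply: h.
  by rewrite tU; apply: h.
have [->|[j0 _]] : t = [::] \/ exists j0, j0 \in t.
- by case: (t) => [|j0 s]; [left|right; exists j0; rewrite mem_head].
- by rewrite !big_nil.
rewrite (big_nth j0) size_map !big_mkord; apply: eq_big => [i|i _].
  by rewrite /amin (nth_map j0).
by rewrite (nth_map j0) // index_uniq.
Qed.

Lemma argmin_exists x U : U != set0 -> exists2 j, j \in U & argmin x U j.
Proof.
case/set0Pn=> j0 j0U; case: (@arg_minP _ _ _ j0 (mem U) x j0U) => j jU jm.
by exists j => //; apply/forall_inP.
Qed.

(** [oddsum_rec] holds for every shortest gap [j], so the sum over arrangements with [j] contracted
    first is the same for all of them, and random tie-breaking averages equal numbers. *)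
Lemma gcost_perms f U x : (#|U| <= f)%N -> ~~ odd #|U| ->
  (forall i, i \in U -> 0 < x i) ->
  \sum_(t <- permutations (enum U)) gcost f (map x t) = #|U|`!%:R * oddsum x U.
Proof.
elim: f U x => [|f IH] U x cf evU px; have [U0|U0] := eqVneq U set0.
- by rewrite U0 enum_set0 big_seq1 /oddsum big1 ?mulr0 // => F; rewrite oddfam0 => /eqP->;
    rewrite /evenmin minsum0 mulr0 if_same mulr0.
- by rewrite leqn0 cards_eq0 (negbTE U0) in cf.
- rewrite U0 enum_set0 big_seq1 /= /oddsum !big_nil mulr0 big1 ?mulr0 // => F.
  by rewrite oddfam0 => /eqP->; rewrite /evenmin minsum0 mulr0 if_same mulr0.
pose T : R := \sum_(j in U | argmin x U j) 1.
rewrite (eq_big_seq (fun t => T^-1 * \sum_(j in U | argmin x U j)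
   (x j + gcost f (contract (index j t) (map x t))))); last first.
  move=> t /mem_perms[ut tU] /=.
  rewrite (big_amin x (fun _ _ => 1) ut tU).
  by rewrite (big_amin x (fun v i => v + gcost f (contract i (map x t))) ut tU).
rewrite -mulr_sumr exchange_big /=.
have T0 : T != 0.
  rewrite /T sumr_const pnatr_eq0 -lt0n; have [j jU jm] := argmin_exists x U0.
  by apply/card_gt0P; exists j; rewrite unfold_in /= jU.
rewrite (eq_bigr (fun=> #|U|`!%:R * oddsum x U)) => [|j /andP[jU jm]].
  rewrite -[RHS](mulKf T0) {2}/T mulr_suml; congr (_ * _).
  by apply: eq_bigr => i _; rewrite mul1r.
have [N cN] : exists N, #|U| = N.+2.
  move: evU; rewrite -cards_eq0 in U0; move: U0; case: #|U| => [|[|N]] // _ _; by exists N.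
rewrite big_split /= big_const_seq count_predT iter_addr addr0 size_permutations ?enum_uniq //.
rewrite -cardE (big_perms_split _ jU) ?cN //.
have evN : ~~ odd N by move: evU; rewrite cN /= negbK.
have Nf : (N <= f)%N by move: cf; rewrite cN; lia.
have cj : #|U :\ j| = N.+1 by have := cardsD1 j U; rewrite jU cN => -[].
(* With [j] first or last, contraction leaves the same arrangement [t] of the other gaps, hence the
   factor 2. *)
rewrite (eq_bigr (fun a => 2 * (N`!%:R * oddsum x (U :\ j :\ a)))); last first.
  move=> a aUj; have ca : #|U :\ j :\ a| = N by have := cardsD1 a (U :\ j); rewrite aUj cj => -[].
  rewrite -ca -(IH (U :\ j :\ a)) ?ca //; last first.
    by move=> i; rewrite !inE => /and3P[_ _]; apply: px.
  rewrite mulr_sumr; apply: eq_big_seq => t /mem_perms[ut tU].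
  have jt : j \notin t by rewrite tU !inE eqxx andbF.
  have aj : a != j by case/setD1P: aUj.
  have -> : index j [:: j, a & t] = 0%N by rewrite /= eqxx.
  have -> : index j (t ++ [:: a; j]) = (size t).+1.
    by rewrite index_cat (negbTE jt) /= (negbTE aj) eqxx addn1.
  by rewrite map_cat -(size_map x t) contract_cat_last /= drop0; ring.
rewrite [X in _ + (_ + X)](eq_bigr (fun p =>
   N`!%:R * oddsum (merge_gap x j p.1 p.2) (U :\ p.1 :\ p.2))); last first.
  move=> -[a b]; rewrite !inE /= => /and3P[/andP[aj aU] /andP[bj bU] ab].
  have ca : #|U :\ a :\ b| = N.
    move: (cardsD1 a U) (cardsD1 b (U :\ a)); rewrite !inE (eq_sym b) ab aU bU cN.
  by rewrite /= !add1n => -[<-] [].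
  rewrite -ca -(IH (U :\ a :\ b)) ?ca //; last first.
    move=> i; rewrite !inE => /and3P[_ _ iU]; rewrite /merge_gap; case: eqP => _; last exact: px.
    by rewrite !addr_gt0 ?px.
  apply: eq_big_seq => t /mem_perms[ut tU].
  have jt : j \in t by rewrite tU !inE eq_sym bj eq_sym aj jU.
  move: ut; case/splitPr: jt => l r; rewrite cat_uniq /= negb_or.
  move=> /and4P[_ /andP[jl _] jr _].
  rewrite insert_around_cat // index_cat (negbTE jl) /= (negbTE aj) eqxx addn1.
  by rewrite contract_mid.
rewrite -!mulr_sumr -[x j *+ _]mulr_natr.
have := oddsum_rec px jU (fun i iU => forall_inP jm i iU) evU; rewrite cN /= => e.
transitivity (N`!%:R * ((N.+2 * N.+1)%:R * oddsum x U)).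
  by rewrite e !factS !natrM; ring.
by rewrite !factS !natrM; ring.
Qed.

End GapCost.

(** * The greedy matching in terms of gaps *)

Section GreedyGaps.
Variable R : realFieldType.

Definition gaps (y : seq R) : seq R :=
  pairmap (fun a b => b - a) (head 0 y) (behead y).

Lemma size_gaps y : size (gaps y) = (size y).-1.
Proof. by rewrite size_pairmap size_behead. Qed.

Lemma nth_gaps y i : (i.+1 < size y)%N -> (gaps y)`_i = y`_i.+1 - y`_i.
Proof.
case: y => // a y /=; rewrite ltnS => iy.
by rewrite /gaps (nth_pairmap 0) //=; case: i iy.
Qed.

Lemma contract_gaps l u v r :
  contract (size l) (gaps (l ++ [:: u, v & r])) = gaps (l ++ r).
Proof.
case: l => [|a l]; first by case: r => [|w r]; rewrite /gaps //= drop0.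
rewrite /gaps ![_ ++ _]cat_cons [behead _]/= [head _ _]/= !pairmap_cat.
rewrite [size _]/= -(size_pairmap (fun a b : R => b - a) a l).
case: r => [|w r]; first exact: etrans (contract_cat_last _ _ _) (esym (cats0 _)).
by apply: etrans (contract_cat _ _ _ _ _) _; congr (_ ++ _ :: _); ring.
Qed.

Variable n : nat.
Variable x : 'I_n -> R.
Hypothesis px : forall i, 0 < x i.
Implicit Types (q : seq 'I_n.+1) (p : 'I_n.+1 * 'I_n.+1).

Lemma pos_lt (i j : 'I_n.+1) : (i < j)%N -> pos x i < pos x j.
Proof.
move=> ij; have iN : (i < n)%N by rewrite (leq_trans ij) // -ltnS.
rewrite /pos [ltRHS](bigID (fun k : 'I_n => (k < i)%N)) /=.
rewrite [X in _ < X + _](eq_bigl (fun k : 'I_n => (k < i)%N)) => [|k]; last first.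
  by apply: andb_idl => ki; apply: ltn_trans ij.
rewrite ltrDl (bigD1 (Ordinal iN)) /= ?ltnn ?ij //.
by apply: ltr_pwDl; rewrite ?px // sumr_ge0 // => k _; apply: ltW.
Qed.

(** Colours alternate from a red first point; together with [sortedq] this is the invariant of the
    greedy process. *)
Definition altq q := forall i, (i < size q)%N -> odd (nth ord0 q i) = odd i.
Definition sortedq q := sorted (fun i j : 'I_n.+1 => (i < j)%N) q.

(** [validp] expects the blue point first; under [altq] it is the one at the odd position. *)
Definition adjpair q i :=
  if odd i then (nth ord0 q i, nth ord0 q i.+1) else (nth ord0 q i.+1, nth ord0 q i).

Local Notation y q i := (pos x (nth ord0 q i)).
Local Notation G q := (gaps (map (pos x) q)).

Section Fixq.
Variable q : seq 'I_n.+1.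
Hypotheses (aq : altq q) (sq : sortedq q).
Local Notation U := [set p in q].

Lemma sortedq_nth_lt i j : (j < size q)%N -> (i < j)%N -> (nth ord0 q i < nth ord0 q j)%N.
Proof.
move=> jq ij; apply: (sorted_ltn_nth _ ord0 sq) => //; last exact: ltn_trans jq.
by move=> ? ? ?; apply: ltn_trans.
Qed.

Lemma sortedq_uniq : uniq q.
Proof.
by apply: sorted_uniq sq => [? ? ?|?]; [apply: ltn_trans | rewrite ltnn].
Qed.

Lemma pos_nth_lt i j : (j < size q)%N -> (i < j)%N -> y q i < y q j.
Proof. by move=> jq ij; apply/pos_lt/sortedq_nth_lt. Qed.

Lemma pos_nth_le i j : (j < size q)%N -> (i <= j)%N -> y q i <= y q j.
Proof. by move=> jq; rewrite leq_eqVlt => /orP[/eqP->//|/pos_nth_lt/ltW->]. Qed.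

Lemma nth_gaps_pos i : (i.+1 < size q)%N -> (G q)`_i = y q i.+1 - y q i.
Proof.
by move=> iq; rewrite nth_gaps ?size_map // !(nth_map ord0) // ltnW.
Qed.

Lemma valid_adjpair i : (i.+1 < size q)%N -> validp U (adjpair q i).
Proof.
move=> iq; rewrite /validp /adjpair /blue /red.
by case: ifP => oi; rewrite /= !inE !mem_nth ?aq ?(ltnW iq) //= oi.
Qed.

Lemma pdist_adjpair i : (i.+1 < size q)%N -> pdist x (adjpair q i) = (G q)`_i.
Proof.
move=> iq; rewrite nth_gaps_pos // /pdist /adjpair; have h := pos_nth_lt iq (ltnSn i).
by case: ifP => _ /=; [rewrite distrC|]; rewrite ger0_norm // subr_ge0 ltW.
Qed.

(* The witness is the gap that starts at the lower endpoint of [p]. *)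
Lemma validp_gap p : validp U p -> exists2 i, (i.+1 < size q)%N &
  (G q)`_i <= pdist x p /\ (pdist x p <= (G q)`_i -> p = adjpair q i).
Proof.
case: p => u v /and3P[]; rewrite !inE /= /blue /red => uq vq /andP[].
have /(nthP ord0)[a aq' <-] := uq; have /(nthP ord0)[b bq' <-] := vq.
rewrite !aq // => oa ob; rewrite /pdist /=.
case: (ltngtP a b) => [ab|ba|e]; last by rewrite -e oa in ob.
  have a1 : (a.+1 < size q)%N by apply: leq_ltn_trans bq'.
  have ab' := ltnW ab.
  exists a => //; rewrite nth_gaps_pos // distrC ger0_norm ?subr_ge0 ?pos_nth_le //.
  rewrite lerD2r pos_nth_le //; split=> //; rewrite lerD2r => le.
  have [ab1|] := leqP b a.+1; last by move/(pos_nth_lt bq'); rewrite ltNge le.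
  by rewrite /adjpair oa; have -> : a.+1 = b by apply/eqP; rewrite eqn_leq ab.
have b1 : (b.+1 < size q)%N by exact: leq_ltn_trans ba aq'.
have ba' := ltnW ba.
exists b => //; rewrite nth_gaps_pos // ger0_norm ?subr_ge0 ?pos_nth_le //.
rewrite lerD2r pos_nth_le //; split=> //; rewrite lerD2r => le.
have [ab1|] := leqP a b.+1; last by move/(pos_nth_lt aq'); rewrite ltNge le.
by rewrite /adjpair (negbTE ob); have -> : b.+1 = a by apply/eqP; rewrite eqn_leq ba.
Qed.

Lemma aminP i : reflect (forall k, (k.+1 < size q)%N -> (G q)`_i <= (G q)`_k) (amin (G q) i).
Proof.
apply: (iffP (all_nthP 0)) => h k kq; apply: h; move: kq;
  by rewrite size_gaps size_map; case: (size q).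
Qed.

Lemma adjpair_inj i k : (i.+1 < size q)%N -> (k.+1 < size q)%N ->
  adjpair q i = adjpair q k -> i = k.
Proof.
move=> iq kq; have iq' := ltnW iq; have kq' := ltnW kq.
have N a b : (a < size q)%N -> (b < size q)%N -> nth ord0 q a = nth ord0 q b -> a = b.
  by move=> ha hb /eqP; rewrite nth_uniq ?sortedq_uniq // => /eqP.
rewrite /adjpair; case: ifP => oi; case: ifP => ok [].
- by move=> /N; auto.
- by move=> /N e1 /N e2; move: (e1 iq' kq) (e2 iq kq'); lia.
- by move=> /N e1 /N e2; move: (e1 iq kq') (e2 iq' kq); lia.
- by move=> _ /N; auto.
Qed.

(** By [validp_gap] a closest blue-red pair consists of neighbours, so the tied pairs correspond
    bijectively to the positions of minimal gaps. *)
Lemma big_minpairs (V : nmodType) (H : 'I_n.+1 * 'I_n.+1 -> V) :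
  \sum_(p in minpairs x U) H p =
  \sum_(0 <= i < size (G q) | amin (G q) i) H (adjpair q i).
Proof.
have szG i : (i < size (G q))%N = (i.+1 < size q)%N.
  by rewrite size_gaps size_map; case: (size q).
rewrite -big_enum -[RHS]big_filter -[RHS](big_map (adjpair q) predT) /=.
apply: perm_big; apply: uniq_perm; rewrite ?enum_uniq //.
  rewrite map_inj_in_uniq ?filter_uniq ?iota_uniq // => i k.
  rewrite !mem_filter !mem_index_iota /= !szG => /andP[_ iq] /andP[_ kq].
  exact: adjpair_inj.
move=> p; rewrite mem_enum inE; apply/andP/mapP.
  case=> vp /forallP minp; have [i iq [le eqp]] := validp_gap vp.
  have lep k : (k.+1 < size q)%N -> pdist x p <= (G q)`_k.
    by move=> kq; have := minp (adjpair q k); rewrite valid_adjpair //= pdist_adjpair.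
  exists i; last exact/eqp/lep.
  rewrite mem_filter mem_index_iota /= szG iq andbT; apply/aminP => k kq.
  exact: le_trans le (lep _ kq).
case=> i; rewrite mem_filter mem_index_iota /= szG => /andP[/aminP mi iq] ->.
split; first exact: valid_adjpair.
apply/forallP => p'; apply/implyP => /validp_gap[k kq [le _]].
by rewrite pdist_adjpair //; apply: le_trans le; apply: mi.
Qed.

Lemma setD_adjpair i : (i.+1 < size q)%N ->
  U :\ (adjpair q i).1 :\ (adjpair q i).2 = [set p in take i q ++ drop i.+2 q].
Proof.
move=> iq; have eq : q = take i q ++ [:: nth ord0 q i, nth ord0 q i.+1 & drop i.+2 q].
  by rewrite -!drop_nth ?cat_take_drop // ltnW.
have := sortedq_uniq; rewrite /adjpair; move: eq; move: (nth _ _ i) (nth _ _ i.+1) => u v eq.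
rewrite {1}eq cat_uniq /= !inE !negb_or => /and5P[_ /and3P[ul vl _] /andP[uv ur] vr _].
apply/setP=> w; rewrite !inE {1}eq !mem_cat !inE.
have [->|wu] := eqVneq w u; first by case: (odd i); rewrite /= ?eqxx ?andbF (negbTE ul) (negbTE ur).
have [->|wv] := eqVneq w v; first by case: (odd i); rewrite /= ?eqxx ?andbF (negbTE vl) (negbTE vr).
by case: (odd i); rewrite /= wu wv.
Qed.

(** Later positions shift by 2, which preserves their parity. *)
Lemma altq_del i : (i.+1 < size q)%N -> altq (take i q ++ drop i.+2 q).
Proof.
move=> iq k; rewrite size_cat nth_cat size_take (ltnW iq) size_drop => kq.
case: ltnP => ki; first by rewrite nth_take // aq // (ltn_trans ki) // ltnW.
rewrite nth_drop aq; last by lia.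
by rewrite !addSn addnC subnK //= negbK.
Qed.

Lemma sortedq_del i : sortedq (take i q ++ drop i.+2 q).
Proof.
apply: (subseq_sorted _ _ sq); first by move=> ? ? ?; apply: ltn_trans.
rewrite -{3}(cat_take_drop i q) cat_subseq // -addn2 addnC -drop_drop.
exact: drop_subseq.
Qed.

Lemma contract_gaps_pos i : (i.+1 < size q)%N -> contract i (G q) = G (take i q ++ drop i.+2 q).
Proof.
move=> iq; have := contract_gaps (map (pos x) (take i q)) (y q i) (y q i.+1)
  (map (pos x) (drop i.+2 q)).
rewrite size_map size_takel; last by rewrite ltnW // ltnW.
by rewrite -!map_cons -!map_cat -!drop_nth ?cat_take_drop // ltnW.
Qed.
End Fixq.

Lemma greedyE_gcost f q : altq q -> sortedq q ->
  greedyE x f [set p in q] = gcost f (G q).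
Proof.
elim: f q => //= f IH q aq sq.
rewrite -(big_minpairs aq sq (fun=> 1)) sumr_const.
(* When no pair is left, the inverse of 0 is 0 and both costs vanish. *)
case: eqP => [->|_]; first by rewrite cards0 invr0 mul0r.
congr (_ * _); rewrite (big_minpairs aq sq) big_seq_cond [RHS]big_seq_cond.
apply: eq_bigr => i; rewrite mem_index_iota size_gaps size_map => /andP[/andP[_ iq] _].
have iq' : (i.+1 < size q)%N by move: iq; case: (size q).
rewrite pdist_adjpair // contract_gaps_pos // -IH ?setD_adjpair //.
  exact: altq_del.
exact: sortedq_del.
Qed.
End GreedyGaps.

(** * Counting families by type *)

Section CountTyped.
Variables (I : finType) (K : nat).
Implicit Types (U A B : {set I}) (F : {set {set I}}) (c : nat -> nat).

Definition blocks F (i : nat) : {set {set I}} := [set A in F | #|A| == i].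

(** Multiplicities are a function on [nat] and the bound [K] stays fixed, so that an induction can
    lower one multiplicity and shrink [U] without changing types. *)
Definition typed U c F :=
  [&& trivIset F, cover F \subset U, [forall A in F, #|A| <= K]%N &
      [forall i : 'I_K.+1, #|blocks F i| == c i]].

Lemma typedP U c F : reflect
  [/\ trivIset F, cover F \subset U, (forall A, A \in F -> #|A| <= K)%N &
      (forall i, (i <= K)%N -> #|blocks F i| = c i)] (typed U c F).
Proof.
apply: (iffP and4P) => -[tF sF bF cF]; split=> //.
- exact/forall_inP.
- by move=> i iK; apply/eqP; move/forallP: cF => /(_ (Ordinal (iK : i < K.+1)%N)).
- exact/forall_inP.
- by apply/forallP=> i; rewrite cF // -ltnS.
Qed.

Lemma card_blocksU1 A F i : A \notin F ->
  #|blocks (A |: F) i| = (#|blocks F i| + (#|A| == i))%N.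
Proof.
move=> AF; case: (eqVneq #|A| i) => e.
  have -> : blocks (A |: F) i = A |: blocks F i.
    by apply/setP=> B; rewrite !inE; case: eqVneq => // ->; rewrite e eqxx.
  by rewrite cardsU1 inE (negbTE AF) addnC.
rewrite addn0; congr #|pred_of_set _|; apply/setP=> B; rewrite !inE.
by case: eqVneq => // ->; rewrite (negbTE e) (negbTE AF).
Qed.

(** Deleting [A] and adding it back are inverse: a nonempty set disjoint from the cover is not
    already a block. *)
Lemma card_typed_block U A c : A \subset U -> (0 < #|A| <= K)%N -> (0 < c #|A|)%N ->
  #|[set F | typed U c F & A \in F]| =
  #|[set F | typed (U :\: A) (fun i => c i - (#|A| == i))%N F]|.
Proof.
move=> sA /andP[A0 AK] c0; rewrite -!sum1dep_card.
rewrite (reindex_onto (fun F => A |: F) (fun F => F :\ A)) /=; last first.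
  by move=> F /andP[_ AF]; rewrite setD1K.
apply: eq_bigl => F; rewrite setU11 andbT; apply/andP/typedP.
  case=> /typedP[tF sF bF cF] /eqP e.
  have nA : A \notin F by rewrite -e !inE eqxx.
  split.
  - by apply: trivIsetS tF; apply: subsetUr.
  - rewrite subsetD; apply/andP; split.
      by apply: subset_trans sF; rewrite cover_setU1 subsetUr.
    by have := coverD1_disjoint (setU11 A F) tF; rewrite setU1K // disjoint_sym.
  - by move=> B BF; apply: bF; rewrite inE BF orbT.
  - by move=> i iK; rewrite -cF // card_blocksU1 // addnK.
case=> tF; rewrite subsetD disjoint_sym => /andP[sF dF] bF cF.
have nA : A \notin F by apply: (fresh_block _ dF); rewrite -card_gt0.
rewrite setU1K // eqxx; split=> //; apply/typedP; split.
- exact: trivIset_addblock.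
- by rewrite cover_setU1 subUset sA.
- by move=> B /setU1P[->|/bF].
- move=> i iK; rewrite card_blocksU1 // cF // subnK //.
  by case: eqP => // <-.
Qed.

(** A multinomial count, multiplied out to stay in [nat], by induction on the number of blocks. The
    condition [c 0 = 0] matters because a set of sets holds the empty block at most once. *)
Lemma card_typed U c : c 0%N = 0%N -> (\sum_(i < K.+1) i * c i <= #|U|)%N ->
  (#|[set F | typed U c F]| * (#|U| - \sum_(i < K.+1) i * c i)`! *
    \prod_(i < K.+1) (i`! ^ c i * (c i)`!) = #|U|`!)%N.
Proof.
have [r] := ubnP (\sum_(i < K.+1) c i)%N.
elim: r c U => // r IH c U; rewrite ltnS => cr c0 cU.
case: (pickP (fun i : 'I_K.+1 => (0 < c i)%N)) => [i ci|c00]; last first.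
  have c00' (i : 'I_K.+1) : c i = 0%N by apply/eqP; rewrite -leqn0 leqNgt c00.
  rewrite !big1 => [|i _|i _]; rewrite ?c00' // ?muln0 //.
  rewrite subn0 muln1 (_ : [set F | _] = [set set0]) ?cards1 ?mul1n //.
  apply/setP=> F; rewrite !inE; apply/typedP/eqP => [[_ _ bF cF]|->].
    apply/eqP; rewrite -subset0; apply/subsetP => A AF.
    have := cF _ (bF _ AF); rewrite (c00' (Ordinal (bF _ AF : _ < K.+1)%N)).
    by move/eqP; rewrite cards_eq0 => /eqP/setP/(_ A); rewrite !inE AF eqxx.
  split.
  - by apply/trivIsetP=> A B; rewrite inE.
  - by rewrite /cover big_set0 sub0set.
  - by move=> A; rewrite inE.
  - move=> i iK; rewrite (c00' (Ordinal (iK : i < K.+1)%N)).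
    by apply/eqP; rewrite cards_eq0; apply/eqP/setP => A; rewrite !inE.
pose c' l := (c l - (i == l :> nat))%N.
have i0 : (0 < i)%N by move: ci; rewrite lt0n; case: (i : nat) => //; rewrite c0.
have c'i : c' i = (c i).-1 by rewrite /c' eqxx subn1.
have c'l (l : 'I_K.+1) : l != i -> c' l = c l.
  by rewrite /c' eq_sym => /negbTE; rewrite -val_eqE /= => ->; rewrite subn0.
have sumi : (\sum_(l < K.+1) l * c l = i + \sum_(l < K.+1) l * c' l)%N.
  rewrite (bigD1 i) //= [in RHS](bigD1 i) //= c'i addnA -mulnS prednK //; congr (_ + _)%N.
  by apply: eq_bigr => l li; rewrite c'l.
have prodi : (\prod_(l < K.+1) (l`! ^ c l * (c l)`!) =
    i`! * c i * \prod_(l < K.+1) (l`! ^ c' l * (c' l)`!))%N.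
  rewrite (bigD1 i) //= [in RHS](bigD1 i) //= c'i -[in LHS](prednK ci) factS expnS.
  rewrite [X in (_ * X)%N](eq_bigr (fun l : 'I_K.+1 => (l`! ^ c' l * (c' l)`!)%N)); last first.
    by move=> l li; rewrite c'l.
  by rewrite prednK //; lia.
have sumc : (\sum_(l < K.+1) c' l < r)%N.
  apply: leq_trans cr; rewrite [X in (X < _)%N](bigD1 i) //= [X in (_ < X)%N](bigD1 i) //= c'i.
  by rewrite (eq_bigr (fun l : 'I_K.+1 => c l)) ?ltn_add2r ?prednK // => l li; rewrite c'l.
have iU : (i <= #|U|)%N by apply: leq_trans cU; rewrite sumi leq_addr.
(* Pairs of a family and one of its blocks of size [i], counted in two ways. *)
have count : (#|[set F | typed U c F]| * c i =
    \sum_(A : {set I} | (A \subset U) && (#|A| == i)) #|[set F | typed (U :\: A) c' F]|)%N.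
  rewrite -sum_nat_const (eq_bigr (fun F => \sum_(A in blocks F i) 1)%N); last first.
    by move=> F; rewrite inE => /typedP[_ _ _ cF]; rewrite sum1_card cF // -ltnS.
  rewrite (exchange_big_dep (fun A : {set I} => (A \subset U) && (#|A| == i))) /=; last first.
    move=> F A; rewrite !inE => /typedP[_ sF _ _] /andP[AF ->].
    by rewrite (subset_trans (sub_cover AF) sF).
  apply: eq_bigr => A /andP[sA /eqP cA]; have := @card_typed_block U A c sA; rewrite cA.
  rewrite i0 -ltnS ltn_ord => <- //; rewrite sum1dep_card.
  congr #|pred_of_set _|; apply/setP => F; rewrite !inE cA eqxx andbT //.
rewrite prodi; set P := (\prod_(l < _) _)%N; set S := (#|U| - _)%N.
transitivity (i`! * \sum_(A : {set I} | (A \subset U) && (#|A| == i)) (#|U| - i)`!)%N.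
  transitivity (i`! * (#|[set F | typed U c F]| * c i * (S`! * P)))%N; first by lia.
  rewrite count big_distrl /=; congr (_ * _)%N; apply: eq_bigr => A /andP[sA /eqP cA].
  rewrite -cA -(cardsDS sA) mulnA /S sumi subnDA -cA -(cardsDS sA); apply: IH => //.
    by rewrite /c' c0.
  by rewrite cardsDS // cA leq_subRL // -sumi.
rewrite sum_nat_const.
have -> : #|[pred A : {set I} | (A \subset U) && (#|A| == i)]| = 'C(#|U|, i).
  by rewrite -cards_draws -sum1dep_card -sum1_card; apply: eq_bigl.
by rewrite mulnCA bin_fact.
Qed.

End CountTyped.

(** * From multisets of odd parts to families, and conclusion *)

Section ByType.
Variables (R : realFieldType) (n : nat).
Implicit Types (F : {set {set 'I_n}}) (x : 'I_n -> R).

Lemma big_blocks (T : Type) (idx : T) (op : Monoid.com_law idx) (I : finType) k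
    (F : {set {set I}}) (h : nat -> T) : (forall A, A \in F -> #|A| <= k)%N ->
  \big[op/idx]_(A in F) h #|A| =
  \big[op/idx]_(i < k.+1) \big[op/idx]_(A in blocks F i) h i.
Proof.
move=> bF; rewrite (partition_big (fun A : {set I} => inord #|A| : 'I_k.+1) predT) //=.
apply: eq_bigr => i _; apply: eq_big => [A|A /andP[AF /eqP <-]]; last by rewrite inordK // ltnS bF.
rewrite inE; case AF: (A \in F) => //=; rewrite -val_eqE /= inordK //.
by rewrite ltnS bF.
Qed.

Section FixType.
Variables (k : nat) (c : mult k).
Hypothesis oc : inO c.

Lemma inO_odd (i : 'I_k.+1) : (0 < c i)%N -> odd i.
Proof. by rewrite lt0n; case/andP: oc => /forallP/(_ i)/implyP. Qed.

Lemma inO_sum : (\sum_(i < k.+1) i * c i)%N = k.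
Proof. by case/andP: oc => _ /eqP. Qed.

Lemma inO_0 (i : 'I_k.+1) : i = 0%N :> nat -> c i = 0%N :> nat.
Proof. by move=> i0; apply/eqP; rewrite -leqn0 leqNgt; apply/negP => /inO_odd; rewrite i0. Qed.

Lemma Phi_typed F : (F \in Phi n c) = typed k setT (fun i => c (inord i)) F.
Proof.
rewrite inE /inPhi /typed subsetT /=; congr [&& _, _ & _].
by apply: eq_forallb => i; rewrite inord_val.
Qed.

Lemma card_Phi : (k <= n)%N ->
  (#|Phi n c| * (n - k)`! * \prod_(i < k.+1) (i`! ^ c i * (c i)`!))%N = n`!.
Proof.
move=> kn; have e : (\sum_(i < k.+1) i * c (inord i) = k)%N.
  by rewrite -[RHS]inO_sum; apply: eq_bigr => i _; rewrite inord_val.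
have := @card_typed 'I_n k setT (fun i => c (inord i)).
rewrite e cardsT card_ord => <- //; last by rewrite inO_0 // inordK.
congr (_ * _ * _)%N; first by apply: eq_card => F; rewrite Phi_typed inE.
by apply: eq_bigr => i _; rewrite inord_val.
Qed.

Lemma nparts_gt0 : (0 < k)%N -> (0 < nparts c)%N.
Proof.
move=> k0; rewrite lt0n; apply: contraTneq k0 => /eqP; rewrite sum_nat_eq0 => /forallP h.
by rewrite -[k]inO_sum big1 // => i _; rewrite (eqP (h i)) muln0.
Qed.

(** Writing [i! = i (i-1)!] in [card_Phi] separates the denominator [B] of [Pw] from the factorials
    [A] of the weight. Passing from [2^(r-1)] to [2^r], possible as [r > 0], accounts for the 2 in
    [coef]. *)
Lemma Pw_card_Phi : (0 < k)%N -> (k <= n)%N ->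
  Pw R c / #|Phi n c|%:R = coef R n k * \prod_(i < k.+1) (2 * (i.-1)`!)%:R ^+ c i.
Proof.
move=> k0 kn; rewrite /Pw /coef -(card_Phi kn).
pose A := (\prod_(i < k.+1) (i.-1)`! ^ c i)%N.
pose B := (\prod_(i < k.+1 | (0 < i)%N) ((i : nat) ^ (c i) * (c i)`!))%N.
have -> : (\prod_(i < k.+1) (i`! ^ c i * (c i)`!) = A * B)%N.
  rewrite /A /B (big_mkcond (fun i : 'I_k.+1 => 0 < i)%N) -big_split /=.
  apply: eq_bigr => i _; case: ifP => [|/negbT]; last first.
    by rewrite -eqn0Ngt => /eqP /inO_0 ->.
  by move=> i0; rewrite -{1}(prednK i0) factS prednK // expnMn; lia.
have -> : \prod_(i < k.+1) (2 * (i.-1)`!)%:R ^+ c i = 2 ^+ nparts c * A%:R :> R.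
  rewrite /nparts -prodrXr /A natr_prod -big_split /=.
  by apply: eq_bigr => i _; rewrite natrM exprMn natrX.
rewrite -natr_prod -/B -{2}(prednK (nparts_gt0 k0)) exprS !natrM.
have nz (m : nat) : (0 < m)%N -> m%:R != 0 :> R by rewrite pnatr_eq0 -lt0n.
have hP : #|Phi n c|%:R != 0 :> R.
  by have := card_Phi kn; case: #|_| => [|m]; rewrite ?pnatr_eq0 // => h;
    have := fact_gt0 n; rewrite -h.
have hA : A%:R != 0 :> R by apply: nz; rewrite prodn_gt0 // => i; rewrite expn_gt0 fact_gt0.
have hB : B%:R != 0 :> R.
  by apply: nz; rewrite prodn_cond_gt0 // => i i0; rewrite muln_gt0 expn_gt0 i0 fact_gt0.
have hk := fact_neq0 R (n - k).
move: (2 ^+ _ : R) (#|_|%:R : R) hP ((n - k)`!%:R : R) hk A%:R hA B%:R hB => u v hv w hw a ha b hb.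
by field; rewrite hv hw ha hb.
Qed.

End FixType.

Definition famtype k F : mult k := [ffun i : 'I_k.+1 => inord #|blocks F i|].

Section OddType.
Variables (k : nat) (F : {set {set 'I_n}}).
Hypotheses (oF : oddfam setT F) (kF : #|cover F| = k).

Lemma oddfam_card_le A : A \in F -> (#|A| <= k)%N.
Proof. by move=> AF; rewrite -kF subset_leq_card // sub_cover. Qed.

Lemma oddfam_sum_card : (\sum_(i < k.+1) i * #|blocks F i|)%N = k.
Proof.
case/oddfamP: oF => /eqP tF _ _; rewrite -[RHS]kF -tF.
rewrite (big_blocks _ id oddfam_card_le); apply: eq_bigr => i _.
by rewrite sum_nat_const mulnC.
Qed.

(** [inord] does not truncate: at most [k] blocks have a given size [i > 0], since together they
    cover at most [k] elements, and no block is empty. *)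
Lemma famtypeE (i : 'I_k.+1) : famtype k F i = #|blocks F i| :> nat.
Proof.
rewrite ffunE inordK // ltnS; case: (posnP i) => [i0|i0]; last first.
  apply: leq_trans (_ : \sum_(l < k.+1) l * #|blocks F l| <= k)%N; last by rewrite oddfam_sum_card.
  by rewrite (bigD1 i) //= (leq_trans (leq_pmull _ i0)) // leq_addr.
rewrite [#|_|](_ : _ = 0%N) //; apply/eqP; rewrite cards_eq0 -subset0; apply/subsetP => A.
by rewrite inE i0 cards_eq0 => /andP[AF /eqP A0]; move: (oddfam_set0 oF); rewrite -A0 AF.
Qed.

Lemma famtype_inO : inO (famtype k F).
Proof.
apply/andP; split; last first.
  apply/eqP; rewrite -[RHS]oddfam_sum_card; apply: eq_bigr => i _.
  by rewrite famtypeE.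
apply/forallP => i; apply/implyP; rewrite famtypeE cards_eq0 => /set0Pn[A].
by rewrite inE => /andP[AF /eqP <-]; case/oddfamP: oF => _ /(_ _ AF).
Qed.

Lemma mem_Phi_famtype : F \in Phi n (famtype k F).
Proof.
rewrite inE; apply/and3P; split; first by case/oddfamP: oF.
  by apply/forall_inP => A; apply: oddfam_card_le.
by apply/forallP => i; rewrite famtypeE.
Qed.

End OddType.

Lemma mem_PhiP k (c : mult k) F : inO c -> F \in Phi n c ->
  [/\ oddfam setT F, #|cover F| = k & famtype k F = c].
Proof.
move=> oc; rewrite inE => /and3P[tF /forall_inP bF /forallP cF].
have cF' (i : 'I_k.+1) : #|blocks F i| = c i by apply/eqP/cF.
split.
- apply/oddfamP; split=> // A AF; apply: (inO_odd oc (i := Ordinal (bF _ AF : _ < k.+1)%N)).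
  by rewrite -cF'; apply/card_gt0P; exists A; rewrite inE AF /=.
- rewrite -(eqP tF) (big_blocks _ id bF) -[RHS](inO_sum oc); apply: eq_bigr => i _.
  by rewrite sum_nat_const cF' mulnC.
- by apply/ffunP => i; rewrite ffunE cF' inord_val.
Qed.

Lemma weight_Phi k (c : mult k) F : inO c -> F \in Phi n c ->
  weight R F = \prod_(i < k.+1) (2 * (i.-1)`!)%:R ^+ c i.
Proof.
move=> oc; rewrite inE => /and3P[tF /forall_inP bF /forallP cF].
rewrite /weight (big_blocks _ (fun i => (2 * (i.-1)`!)%:R) bF); apply: eq_bigr => i _.
by rewrite prodr_const (eqP (cF i)).
Qed.

(** Families are sorted by the number [k] of covered gaps and then by type; for [inO c], the set
    [Phi n c] is exactly one such class and has constant weight. The classes with [k] odd or zero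
    vanish by [evenmin]. *)
Lemma sum_type_oddsum x :
  \sum_(k < n.+1 | (0 < k)%N && ~~ odd k)
     \sum_(c : mult k | inO c) Pw R c * fval c x = oddsum x setT.
Proof.
rewrite /oddsum (partition_big (fun F : {set {set 'I_n}} => inord #|cover F| : 'I_n.+1) predT) //=.
rewrite [LHS]big_mkcond; apply: eq_bigr => k _.
have coverk F : (inord #|cover F| == k) = (#|cover F| == k :> nat).
  by rewrite -val_eqE /= inordK // ltnS -[leqRHS]card_ord max_card.
under eq_bigl do rewrite coverk.
case: ifP => [/andP[k0 ek]|/negbT]; last first.
  rewrite negb_and negbK -leqNgt leqn0 => h; rewrite big1 // => F /andP[oF /eqP kF].
  rewrite /evenmin kF; case/orP: h => [/eqP k0|->]; last by rewrite mulr0.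
  have -> : F = set0.
    apply/eqP; rewrite -oddfam0 -(cards0_eq (etrans kF k0)).
    by case/oddfamP: oF => *; apply/oddfamP.
  by rewrite minsum0 mulr0 if_same mulr0.
rewrite [RHS](partition_big (famtype k) (@inO k)) /=; last first.
  by move=> F /andP[oF /eqP kF]; apply: famtype_inO.
apply: eq_bigr => c oc.
rewrite /fval mulrA mulr_sumr; apply: eq_big => [F|F FPhi].
  apply/idP/idP => [/(mem_PhiP oc)[-> -> ->]|/andP[/andP[oF /eqP kF] /eqP <-]].
    by rewrite !eqxx.
  exact: mem_Phi_famtype.
have [oF kF _] := mem_PhiP oc FPhi.
have kn : (k <= n)%N by rewrite -ltnS.
rewrite (Pw_card_Phi oc k0 kn) (weight_Phi oc FPhi) /evenmin kF (negbTE ek) cardsT card_ord.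
ring.
Qed.

Lemma sum_perm_enum (V : nmodType) (H : seq 'I_n -> V) :
  \sum_(s : 'S_n) H (map s (enum 'I_n)) = \sum_(t <- permutations (enum 'I_n)) H t.
Proof.
rewrite -big_enum -(big_map (fun s : 'S_n => map s (enum 'I_n)) predT) /=.
have ul : uniq [seq [seq s i | i <- enum 'I_n] | s : 'S_n <- enum 'S_n].
  rewrite map_inj_uniq ?enum_uniq // => s s' /eq_in_map e.
  by apply/permP => i; apply: e; rewrite mem_enum.
have sub : {subset [seq [seq s i | i <- enum 'I_n] | s : 'S_n <- enum 'S_n]
             <= permutations (enum 'I_n)}.
  move=> t /mapP[s _ ->]; rewrite mem_permutations; apply: uniq_perm.
  - by rewrite map_inj_uniq ?enum_uniq //; apply: perm_inj.
  - exact: enum_uniq.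
  - move=> i; rewrite mem_enum; apply/mapP; exists ((s^-1)%g i); rewrite ?mem_enum //.
    by rewrite permKV.
apply: perm_big; apply: uniq_perm => //; first exact: permutations_uniq.
(* Both lists are duplicate-free with [n!] entries, so the inclusion is an equality. *)
apply: (uniq_min_size ul sub _).2.
rewrite (size_permutations (enum_uniq _)) size_enum_ord size_map -cardE -card_Sn.
by rewrite (eq_card (B := mem 'S_n)).
Qed.

Lemma D_gcost x : (forall i, 0 < x i) -> D x = gcost n.+1 (map x (enum 'I_n)).
Proof.
move=> px; rewrite /D.
have -> : [set: 'I_n.+1] = [set p in enum 'I_n.+1] by apply/setP=> i; rewrite !inE mem_enum.
have nthE i : (i < n.+1)%N -> nth ord0 (enum 'I_n.+1) i = i :> nat.
  by move=> lt; rewrite nth_enum_ord.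
rewrite (greedyE_gcost px); last first.
- by have := iota_ltn_sorted 0 n.+1; rewrite -val_enum_ord sorted_map.
- by move=> i; rewrite size_enum_ord => /nthE ->.
congr (gcost _ _).
have sz : size (map (pos x) (enum 'I_n.+1)) = n.+1 by rewrite size_map size_enum_ord.
apply: (@eq_from_nth _ 0); first by rewrite size_gaps sz size_map size_enum_ord.
rewrite size_gaps sz /= => i iN.
have posE k : (k < n.+1)%N ->
    [seq pos x i | i <- enum 'I_n.+1]`_k = \sum_(j < n | (j < k)%N) x j.
  by move=> kn; rewrite (nth_map ord0) ?size_enum_ord /pos ?nthE.
rewrite nth_gaps ?posE ?sz ?ltnS // ?(ltnW iN) //.
rewrite (nth_map (Ordinal iN)); last by rewrite size_enum_ord.
have -> : nth (Ordinal iN) (enum 'I_n) i = Ordinal iN by apply: val_inj; rewrite /= nth_enum_ord.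
rewrite [X in X - _](bigD1 (Ordinal iN)) //= [X in _ + X - _](eq_bigl (fun j : 'I_n => (j < i)%N)).
  by rewrite addrK.
by move=> j; rewrite /= -val_eqE /= ltnS ltn_neqAle andbC.
Qed.

Lemma E_oddsum x : (forall i, 0 < x i) -> ~~ odd n -> E x = oddsum x setT.
Proof.
move=> px evn; rewrite /E.
rewrite (eq_bigr (fun s : 'S_n => gcost n.+1 (map x (map s (enum 'I_n))))); last first.
  by move=> s _; rewrite -map_comp; apply: D_gcost => i; apply: px.
rewrite (sum_perm_enum (fun t => gcost n.+1 (map x t))).
have -> : enum 'I_n = enum [set: 'I_n] by apply: eq_enum => i; rewrite in_setT.
by rewrite gcost_perms ?cardsT ?card_ord // mulKf // fact_neq0.
Qed.

End ByType.

Theorem theoremA12 (R : realFieldType) (n : nat) (hn : (0 < n)%N)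
    (hev : ~~ odd n) (x : 'I_n -> R) (hx : forall i, 0 < x i) :
  E x = \sum_(k < n.+1 | (0 < k)%N && ~~ odd k)
          \sum_(c : mult k | inO c) Pw R c * fval c x.
Proof. by rewrite E_oddsum // sum_type_oddsum. Qed.
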